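(* Let $P \subseteq \mathbb{R}^3$ be a $3$-dimensional smooth lattice polytope that is centrally symmetric, i.e. $P = -P$. Then $P$ has the integer decomposition property (IDP).
   Context: A lattice polytope in $\mathbb{R}^d$ is the convex hull of finitely many points of $\mathbb{Z}^d$. A lattice polytope $P$ has the integer decomposition property (is IDP) if for every integer $n \ge 1$ and every lattice point $p \in nP \cap \mathbb{Z}^d$ there exist lattice points $p_1,\dots,p_n \in P \cap \mathbb{Z}^d$ with $p = p_1 + \dots + p_n$. A lattice polytope $P$ is smooth if it is simple and at every vertex the primitive edge directions (primitive lattice vectors along the edges emanating from the vertex) form a basis of the lattice $(\operatorname{aff} P) \cap \mathbb{Z}^d$ (translated to the origin). *)

(* Defs.v *)
From mathcomp Require Import all_boot all_order all_algebra.
From mathcomp Require Import boolp classical_sets functions cardinality.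
From mathcomp Require Import reals convex.

Set Implicit Arguments.
Unset Strict Implicit.
Unset Printing Implicit Defensive.

Import Order.TTheory GRing.Theory Num.Theory.

Local Open Scope classical_set_scope.
Local Open Scope card_scope.
Local Open Scope ring_scope.

Section LatticePolytopes.
Variables (R : realType) (d : nat).
Local Notation V := 'rV[R]_d.
Implicit Types (P F A B L : set V) (u v x : V).

Definition lattice_points : set V := [set x | x \is a mxOver Num.int].

Definition convex_hull A : set V := smallest (@convex_set R V) A.

Definition lattice_polytope P :=
  exists2 S : seq V, {in S, forall x, lattice_points x} &
    P = convex_hull [set` S].

Definition affine_hull A : set V :=
  [set x | exists n (p : 'I_n -> V) (c : 'I_n -> R),
     [/\ forall i, A (p i), \sum_i c i = 1 & x = \sum_i c i *: p i]].

(* The empty set has no dimension: its affine hull is empty. *)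
Definition has_dim A (k : nat) :=
  exists v (U : {vspace V}),
    affine_hull A = [set v + u | u in [set` U]] /\ \dim U = k.

(* P itself is a face (a = 0, c = 0), and so may be the empty set;
   vertices and edges are the faces of dimension 0 and 1. *)
Definition face P F :=
  exists (a : V) (c : R),
    (forall x, P x -> (a *m x^T) 0 0 <= c) /\
    F = P `&` [set x | (a *m x^T) 0 0 = c].

Definition vertex P v := face P [set v].

Definition edge P F := face P F /\ has_dim F 1.

Definition simple_polytope P :=
  forall k, has_dim P k ->
    forall v, vertex P v -> [set F | edge P F /\ F v] #= `I_k.

Definition primitive u :=
  [/\ lattice_points u, u != 0 &
      forall (k : nat) w, lattice_points w -> u = w *+ k -> k = 1%N].

Definition primitive_edge_directions P v : set V :=
  [set u | primitive u /\
     exists F, [/\ edge P F, F v & exists2 t : R, 0 < t & F (v + t *: u)]].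

(* Uniqueness of the coefficients makes b injective, so B has m elements. *)
Definition lattice_basis L B :=
  exists m (b : 'I_m -> V),
    [/\ B = range b, B `<=` L &
        forall x, L x ->
          exists! c : {ffun 'I_m -> int}, x = \sum_i b i *~ c i].

Definition smooth P :=
  simple_polytope P /\
  forall v, vertex P v ->
    lattice_basis [set x - v | x in affine_hull P `&` lattice_points]
                  (primitive_edge_directions P v).

Definition centrally_symmetric P := P = [set - x | x in P].

Definition dilate (n : nat) P : set V := [set n%:R *: x | x in P].

Definition IDP P :=
  forall n : nat, (0 < n)%N ->
    forall p, dilate n P p -> lattice_points p ->
      exists q : 'I_n -> V,
        (forall i, P (q i) /\ lattice_points (q i)) /\ p = \sum_i q i.

End LatticePolytopes.

(* Main.v *)
Require Import Defs.
From mathcomp Require Import all_boot all_order all_algebra.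
From mathcomp Require Import classical_sets reals.
From mathcomp Require Import boolp convex interval_inference ring lra zify.

(**
  Let p be a lattice point of nP.  It lies in the cone over some facet F of P,
  hence over a unimodular lattice triangle T = abc in F.  If one of the
  reflections b + c - a, c + a - b, a + b - c of a vertex of T lies in P, then T
  is half of a lattice parallelogram Q in P.  As P = -P, the set conv(Q, -Q) is a
  lattice parallelepiped in P, and it contains conv(0, T); parallelepipeds have
  the integer decomposition property.  If no reflection lies in P, smoothness
  forces F = T.  The three edges of P leaving T then have directions e,
  e + k(b - a) and e + k(c - a), and 0 being an interior point forces k >= 1.  So
  the slice of P at lattice distance 1 from F is a triangle (k + 1)T with
  k + 1 >= 2.  Such a triangle is covered by lattice parallelograms, which takes
  care of the cone from 0 over the slice, and between F and the slice a greedy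
  decomposition works.
*)

Set Implicit Arguments.
Unset Strict Implicit.
Unset Printing Implicit Defensive.

Import Order.TTheory GRing.Theory Num.Theory.

Local Open Scope classical_set_scope.
Local Open Scope ring_scope.

(** * Cones and convex hulls of finite sets *)

Section Integers.
Variable R : realType.
Implicit Types x y : R.

Lemma int_ltD1 x y : x \is a Num.int -> y \is a Num.int -> x < y -> x + 1 <= y.
Proof.
move=> /intrP[m ->] /intrP[n ->]; rewrite ltr_int -lezD1 => h.
by rewrite -[1]/(1%:~R) -intrD ler_int.
Qed.

Lemma int_gt0 x : x \is a Num.int -> 0 < x -> 1 <= x.
Proof. by move=> xZ x0; have := int_ltD1 (int_num0 _) xZ x0; rewrite add0r. Qed.

Lemma int_lt0 x : x \is a Num.int -> x < 0 -> x <= -1.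
Proof. by move=> xZ x0; have := int_ltD1 xZ (int_num0 _) x0; lra. Qed.

Lemma convex_comb_lt x y (t c : R) :
  0 <= t -> t <= 1 -> x < c -> y < c -> t * x + (1 - t) * y < c.
Proof.
rewrite le_eqVlt => /orP[/eqP<- _ _ yc|t0 t1 xc yc]; first by lra.
have : t * x < t * c by rewrite ltr_pM2l.
have : (1 - t) * y <= (1 - t) * c by rewrite ler_wpM2l ?subr_ge0 // ltW.
lra.
Qed.

End Integers.

Lemma minimal_filter (T : eqType) (Q : seq T -> Prop) (S : seq T) : Q S ->
  exists S', [/\ {subset S' <= S}, Q S' &
    {in S', forall s, ~ Q [seq r <- S' | r != s]}].
Proof.
have [n] := ubnP (size S); elim: n S => // n IH S szS QS.
have [[s sS Qs]|none] := pselect (exists2 s, s \in S & Q [seq r <- S | r != s]).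
  have [|S' [sub QS' minS']] := IH _ _ Qs.
    rewrite -ltnS; apply: leq_trans szS; rewrite ltnS size_filter.
    by rewrite -(count_predC (fun r => r != s) S) -[X in (X < _)%N]addn0 ltn_add2l
      -has_count; apply/hasP; exists s => //=; rewrite eqxx.
  by exists S'; split => // r /sub; rewrite mem_filter => /andP[].
by exists S; split => // s sS Qs; apply: none; exists s.
Qed.

Section Dot.
Variables (R : realType) (d : nat).
Local Notation V := 'rV[R]_d.
Implicit Types (a x y : V) (t : R).

Definition dot a x : R := (a *m x^T) 0 0.

Lemma dotE a x : dot a x = \sum_i a 0 i * x 0 i.
Proof. by rewrite /dot mxE; apply: eq_bigr => i _; rewrite mxE. Qed.

Lemma dotC a x : dot a x = dot x a.
Proof. by rewrite !dotE; apply: eq_bigr => i _; rewrite mulrC. Qed.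

Lemma dotDr a x y : dot a (x + y) = dot a x + dot a y.
Proof. by rewrite /dot linearD mulmxDr mxE. Qed.

Lemma dotZr a t x : dot a (t *: x) = t * dot a x.
Proof. by rewrite /dot linearZ -scalemxAr mxE. Qed.

Lemma dotNr a x : dot a (- x) = - dot a x.
Proof. by rewrite -scaleN1r dotZr mulN1r. Qed.

Lemma dotBr a x y : dot a (x - y) = dot a x - dot a y.
Proof. by rewrite dotDr dotNr. Qed.

Lemma dot0r a : dot a 0 = 0.
Proof. by rewrite -(scale0r 0) dotZr mul0r. Qed.

Lemma dotDl a b x : dot (a + b) x = dot a x + dot b x.
Proof. by rewrite dotC dotDr !(dotC x). Qed.

Lemma dotZl t a x : dot (t *: a) x = t * dot a x.
Proof. by rewrite dotC dotZr (dotC x). Qed.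

Lemma dotNl a x : dot (- a) x = - dot a x.
Proof. by rewrite dotC dotNr (dotC x). Qed.

Lemma dotBl a b x : dot (a - b) x = dot a x - dot b x.
Proof. by rewrite dotDl dotNl. Qed.

Lemma dot_sumr a n (x : 'I_n -> V) : dot a (\sum_i x i) = \sum_i dot a (x i).
Proof. by apply: (big_morph (dot a) (dotDr a) (dot0r a)). Qed.

Definition dotr := (dotDr, dotNr, dotZr, dot0r).

Lemma dot_gt0 x : x != 0 -> 0 < dot x x.
Proof.
move=> x0; have [i xi] : exists i, x 0 i != 0.
  apply/existsP; apply: contraNT x0 => /existsPn h.
  by apply/eqP/rowP => i; rewrite mxE; apply/eqP; rewrite -[_ == _]negbK; exact: h.
rewrite dotE (bigD1 i) //= ltr_pwDl //; last by apply: sumr_ge0 => j _;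
  rewrite -expr2 sqr_ge0.
by rewrite -expr2 exprn_even_gt0.
Qed.

Lemma dot_int a x : lattice_points a -> lattice_points x -> dot a x \is a Num.int.
Proof.
move=> /mxOverP aZ /mxOverP xZ; rewrite dotE; apply: rpred_sum => i _.
by rewrite rpredM.
Qed.

Lemma lattice0 : lattice_points (0 : V).
Proof. by apply/mxOverP => i j; rewrite mxE rpred0. Qed.

Lemma latticeD x y : lattice_points x -> lattice_points y -> lattice_points (x + y).
Proof. by move=> /mxOverP xZ /mxOverP yZ; apply/mxOverP => i j; rewrite mxE rpredD. Qed.

Lemma latticeN x : lattice_points x -> lattice_points (- x).
Proof. by move=> /mxOverP xZ; apply/mxOverP => i j; rewrite mxE rpredN. Qed.

Lemma latticeB x y : lattice_points x -> lattice_points y -> lattice_points (x - y).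
Proof. by move=> xZ yZ; apply: latticeD => //; apply: latticeN. Qed.

Lemma latticeZ t x : t \is a Num.int -> lattice_points x -> lattice_points (t *: x).
Proof. by move=> tZ /mxOverP xZ; apply/mxOverP => i j; rewrite mxE rpredM. Qed.

Lemma latticeDZ t x y : t \is a Num.int -> lattice_points x -> lattice_points y ->
  lattice_points (x + t *: y).
Proof. by move=> tZ xZ yZ; apply: latticeD => //; apply: latticeZ. Qed.

End Dot.

Section Cones.
Variables (R : realType) (d : nat).
Local Notation V := 'rV[R]_d.
Implicit Types (a f g s x y : V) (t : R) (S : seq V).

Fixpoint conic S x : Prop :=
  if S is s :: S' then exists2 t, 0 <= t & conic S' (x - t *: s) else x = 0.

Lemma conic0 S : conic S 0.
Proof. by elim: S => //= s S IH; exists 0 => //; rewrite scale0r subr0. Qed.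

Lemma conicD S x y : conic S x -> conic S y -> conic S (x + y).
Proof.
elim: S x y => /= [|s S IH] x y; first by move=> -> ->; rewrite addr0.
move=> [t t0 xS] [u u0 yS]; exists (t + u); first exact: addr_ge0.
by rewrite scalerDl opprD addrACA; apply: IH.
Qed.

Lemma conicZ S t x : 0 <= t -> conic S x -> conic S (t *: x).
Proof.
move=> t0; elim: S x => /= [|s S IH] x; first by move=> ->; rewrite scaler0.
move=> [u u0 xS]; exists (t * u); first exact: mulr_ge0.
by rewrite -scalerA -scalerBr; apply: IH.
Qed.

Lemma conic_mem S s : s \in S -> conic S s.
Proof.
elim: S => //= r S IH; rewrite inE => /predU1P[->|sS].
  by exists 1 => //; rewrite scale1r subrr; apply: conic0.
by exists 0 => //; rewrite scale0r subr0; apply: IH.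
Qed.

Lemma conic_min (K : V -> Prop) S : K 0 ->
  (forall x y, K x -> K y -> K (x + y)) ->
  (forall t x, 0 <= t -> K x -> K (t *: x)) ->
  {in S, forall s, K s} -> forall x, conic S x -> K x.
Proof.
move=> K0 KD KZ; elim: S => [|s S IH] KS x /=; first by move=> ->.
move=> [t t0 xS]; rewrite -(subrK (t *: s) x); apply: KD.
  by apply: IH => // r rS; apply: KS; rewrite inE rS orbT.
by apply: KZ => //; apply: KS; rewrite mem_head.
Qed.

(* If f separates x from the first generators but f s > 0, project along s onto
   the kernel of f and separate there. *)
Lemma farkas S x :
  conic S x \/ exists f, {in S, forall s, dot f s <= 0} /\ 0 < dot f x.
Proof.
have [n] := ubnP (size S); elim: n S x => // n IH [|s S] x /= szS.
  by have [->|x0] := eqVneq x 0; [left | right; exists x; split => //; exact: dot_gt0].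
have [xS|[f [fS fx]]] := IH S x szS.
  by left; exists 0 => //; rewrite scale0r subr0.
have [fs|fs] := lerP (dot f s) 0.
  by right; exists f; split => // r; rewrite inE => /predU1P[->|/fS].
pose proj y := y - (dot f y / dot f s) *: s.
have [|xS|[g [gS gx]]] := IH (map proj S) (proj x); first by rewrite size_map.
  left; suff : conic (s :: S) (proj x + (dot f x / dot f s) *: s) by rewrite subrK.
  apply: conicD; last first.
    by apply: conicZ; [apply: divr_ge0; exact: ltW | apply: conic_mem;
      rewrite mem_head].
  apply: (@conic_min _ (map proj S)) xS => [||t y t0|_ /mapP[r rS ->]].
  - exact: conic0.
  - exact: conicD.
  - exact: conicZ.
  - rewrite /proj -scaleNr; apply: conicD; first by apply: conic_mem;
    rewrite inE rS orbT.
    apply: conicZ; last by apply: conic_mem; rewrite mem_head.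
    by rewrite -mulNr; apply: divr_ge0; [rewrite oppr_ge0; exact: fS | exact: ltW].
have projE y : dot (g - (dot g s / dot f s) *: f) y = dot g (proj y).
  by rewrite dotBl dotBr dotZl dotZr mulrAC [in RHS]mulrC mulrA.
right; exists (g - (dot g s / dot f s) *: f); split; last by rewrite projE.
move=> r; rewrite projE inE => /predU1P[->|rS]; last by apply: gS; exact: map_f.
by rewrite /proj divff ?gt_eqF // scale1r subrr dot0r.
Qed.

End Cones.

Section Hulls.
Variables (R : realType) (d : nat).
Local Notation V := 'rV[R]_d.
Implicit Types (P K : set V) (a f g s x y : V) (t : R) (S : seq V).

Definition cvx K := forall x y t, 0 <= t -> t <= 1 -> K x -> K y ->
  K (t *: x + (1 - t) *: y).

Lemma convex_setP K : convex_set K <-> cvx K.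
Proof.
split=> [cK x y t t0 t1 Kx Ky|cK x y l /set_mem Kx /set_mem Ky].
  have /= := cK x y (Itv01 t0 t1) (mem_set Kx) (mem_set Ky).
  by move=> /set_mem.
by apply/mem_set; apply: cK.
Qed.

Lemma hull_mem S s : s \in S -> convex_hull [set` S] s.
Proof. by move=> sS; apply: sub_gen_smallest. Qed.

Lemma hull_min S K : cvx K -> {in S, forall s, K s} ->
  forall x, convex_hull [set` S] x -> K x.
Proof.
by move=> cK SK x; apply: (@smallest_sub _ _ [set` S] K);
  [exact/convex_setP | exact: SK].
Qed.

Lemma hull_cvx S : cvx (convex_hull [set` S]).
Proof.
move=> x y t t0 t1 Px Py K [cK SK].
by have /convex_setP := cK; apply => //; [apply: Px | apply: Py].
Qed.

Lemma cvx_halfspace f (c : R) : cvx [set x | dot f x <= c].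
Proof. by move=> x y t t0 t1 /= hx hy; rewrite !dotr; nra. Qed.

Lemma hull_le S f (c : R) : {in S, forall s, dot f s <= c} ->
  forall x, convex_hull [set` S] x -> dot f x <= c.
Proof. by move=> h; apply: hull_min; [exact: cvx_halfspace | exact: h]. Qed.

Lemma cone_cvx K : (forall x y, K x -> K y -> K (x + y)) ->
  (forall t x, 0 <= t -> K x -> K (t *: x)) ->
  forall v, cvx [set x | K (x - v)].
Proof.
move=> KD KZ v x y t t0 t1 /= Kx Ky.
suff -> : t *: x + (1 - t) *: y - v = t *: (x - v) + (1 - t) *: (y - v).
  by apply: KD; apply: KZ => //; lra.
by apply/rowP => i; rewrite !mxE; ring.
Qed.

Lemma hull_sep S x : convex_hull [set` S] x \/
  exists f (c : R), {in S, forall s, dot f s <= c} /\ c < dot f x.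
Proof.
pose hm (y : V) : 'rV[R]_(1 + d) := row_mx (const_mx 1) y.
have dotE (f : 'rV[R]_(1 + d)) y : dot f (hm y) = f 0 0 + dot (rsubmx f) y.
  rewrite -{1}(hsubmxK f) /dot tr_row_mx mul_row_col mxE; congr (_ + _).
  rewrite mxE big_ord1 !mxE mulr1; congr (f _ _); exact/val_inj.
have [xS|[f [fS fx]]] := farkas (map hm S) (hm x); last first.
  right; exists (rsubmx f), (- f 0 0); split=> [s sS|].
    by have := fS _ (map_f hm sS); rewrite dotE; lra.
  by move: fx; rewrite dotE; lra.
left; pose K (z : 'rV[R]_(1 + d)) := z = 0 \/
  exists t y, [/\ 0 < t, convex_hull [set` S] y & z = t *: hm y].
have : K (hm x).
  apply: (@conic_min _ _ K) xS => [|z w|t z|_ /mapP[s sS ->]].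
  - by left.
  - move=> [->|[t [y [t0 Py ->]]]]; first by rewrite add0r.
    move=> [->|[u [y' [u0 Py' ->]]]]; first by rewrite addr0; right; exists t, y.
    right; exists (t + u), ((t / (t + u)) *: y + (1 - t / (t + u)) *: y'); split.
    + exact: addr_gt0.
    + apply: hull_cvx => //; first by apply: divr_ge0; [|apply: addr_ge0]; exact: ltW.
      by rewrite ler_pdivrMr ?addr_gt0 // mul1r lerDl ltW.
    + rewrite !scale_row_mx add_row_mx; congr row_mx.
        by apply/rowP => i; rewrite !mxE; ring.
      have tu : t + u != 0 by rewrite gt_eqF ?addr_gt0.
      by apply/rowP => i; rewrite !mxE; field.
  - rewrite le_eqVlt => /orP[/eqP<- _|t0 [->|[u [y [u0 Py ->]]]]].
    + by left; rewrite scale0r.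
    + by left; rewrite scaler0.
    + by right; exists (t * u), y; split=> //; [exact: mulr_gt0 | rewrite scalerA].
  - by right; exists 1, s; split=> //; [exact: hull_mem | rewrite scale1r].
move=> [/rowP/(_ 0)|[t [y [t0 Py]]]].
  by rewrite mxE; case: splitP => // j _; rewrite !mxE => /eqP; rewrite oner_eq0.
rewrite /hm scale_row_mx => /eq_row_mx[/rowP/(_ 0)]; rewrite !mxE mulr1 => <-.
by rewrite scale1r => ->.
Qed.

End Hulls.

(** * Vertices and edges of lattice polytopes *)

Section Vertices.
Variables (R : realType) (d : nat).
Local Notation V := 'rV[R]_d.
Implicit Types (P K : set V) (a f g s v x y : V) (t : R) (S : seq V).

Lemma polytope_vertices P : lattice_polytope P ->
  exists S, [/\ {in S, forall s, lattice_points s}, P = convex_hull [set` S] &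
    {in S, forall v, exists2 f, vertex P v &
       {in S, forall s, s != v -> dot f s < dot f v}}].
Proof.
move=> [S0 S0Z PS0].
have [S [sub PS minS]] := minimal_filter (Q := fun L => P = convex_hull [set` L]) PS0.
exists S; split=> // [s /sub/S0Z //|v vS].
have [vP|[f [c [fS fv]]]] := hull_sep [seq r <- S | r != v] v.
  exfalso; apply: (minS v vS); rewrite PS; apply/seteqP; split=> x.
    apply: hull_min; first exact: hull_cvx.
    move=> s sS; have [->//|sv] := eqVneq s v.
    by apply: hull_mem; rewrite mem_filter sv.
  apply: hull_min; first exact: hull_cvx.
  by move=> s; rewrite mem_filter => /andP[_ sS]; exact: hull_mem.
have strict s : s \in S -> s != v -> dot f s < dot f v.
  by move=> sS sv; apply: le_lt_trans fv; apply: fS; rewrite mem_filter sv.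
exists f => //; exists f, (dot f v); split.
  rewrite PS; apply: hull_le => s sS.
  by have [->//|sv] := eqVneq s v; rewrite ltW // strict.
apply/seteqP; split=> [x ->|x [Px fx]].
  by split => //; rewrite PS; exact: hull_mem.
suff [|//] : dot f x < dot f v \/ x = v by rewrite /dot fx ltxx.
move: x {fx} Px; rewrite PS; apply: (@hull_min _ _ _ [set x | dot f x < dot f v \/ x
  = v]).
  move=> x y t t0 t1 /= [fx|->] [fy|->].
  - by left; rewrite !dotr; exact: convex_comb_lt.
  - have [->|tn0] := eqVneq t 0; first by right; rewrite scale0r add0r subr0 scale1r.
    have tgt : 0 < t by rewrite lt_neqAle eq_sym tn0.
    by left; rewrite !dotr; nra.
  - have [->|tn1] := eqVneq t 1; first by right; rewrite subrr scale0r addr0 scale1r.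
    have tlt : t < 1 by rewrite lt_neqAle tn1.
    by left; rewrite !dotr; nra.
  - by right; rewrite -scalerDl addrC subrK scale1r.
by move=> s sS /=; have [->|sv] := eqVneq s v; [right | left; exact: strict].
Qed.

Lemma lattice_primitive x : lattice_points x -> x != 0 ->
  exists k w, [/\ (0 < k)%N, primitive w & x = w *+ k].
Proof.
move=> xZ x0; have [i xi] : exists i, x 0 i != 0.
  apply/existsP; apply: contraNT x0 => /existsPn h.
  by apply/eqP/rowP => i; rewrite mxE; apply/eqP; rewrite -[_ == _]negbK; exact: h.
pose Q k := `[< exists2 w, lattice_points w & x = w *+ k >].
have exQ : exists k, Q k by exists 1%N; apply/asboolP; exists x.
have [N xN] : exists N : nat, `|x 0 i| <= N%:R.
  by exists (Num.bound `|x 0 i|); exact/ltW/archi_boundP.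
have boundQ k : Q k -> (k <= N)%N.
  move=> /asboolP[w /mxOverP wZ xw]; rewrite -(ler_nat R); apply: le_trans xN.
  rewrite xw mulmxnE normrMn -[leRHS]mulr_natl ler_peMr //.
  have /intrP[m wm] := wZ 0 i; rewrite wm -intr_norm -[1]/(1%:~R) ler_int -gtz0_ge1.
  rewrite normr_gt0; apply: contraNneq xi => m0.
  by rewrite xw mulmxnE wm m0 mul0rn.
case: (ex_maxnP exQ boundQ) => k /asboolP[w wZ xw] kmax.
have k0 : (0 < k)%N by rewrite lt0n; apply: contraNneq x0 => k0; rewrite xw k0 mulr0n.
exists k, w; split=> //; split=> //.
  by apply: contraNneq x0 => w0; rewrite xw w0 mul0rn.
move=> j z zZ wz; apply/eqP; rewrite eqn_leq; apply/andP; split.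
  rewrite -(leq_pmul2l k0) muln1 mulnC; apply: kmax; apply/asboolP; exists z => //.
  by rewrite xw wz -mulrnA.
by rewrite lt0n; apply: contraNneq x0 => j0; rewrite xw wz j0 mulr0n mul0rn.
Qed.

(* A generator g that is extreme among the generators lies on an edge: a functional f
   separating g from the others is tilted along a, which is negative on the whole
   cone, until it vanishes at g. *)
Lemma edge_generators P S v : P = convex_hull [set` S] ->
  {in S, forall s, lattice_points s} ->
  v \in S -> (exists f, {in S, forall s, s != v -> dot f s < dot f v}) ->
  exists G, {in S, forall s, conic G (s - v)} /\
    {in G, forall g, exists k w,
      [/\ (0 < k)%N, primitive_edge_directions P v w & g = w *+ k]}.
Proof.
move=> PS SZ vS [a aS].
pose G0 := [seq s - v | s <- S & s != v].
have G0S : {in S, forall s, conic G0 (s - v)}.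
  move=> s sS; have [->|sv] := eqVneq s v; first by rewrite subrr; exact: conic0.
  by apply: conic_mem; apply/mapP; exists s => //; rewrite mem_filter sv.
have [G [sub GS minG]] := minimal_filter (Q :=
  fun L => {in S, forall s, conic L (s - v)}) G0S.
have aG g : g \in G -> dot a g < 0.
  move=> /sub/mapP[s]; rewrite mem_filter => /andP[sv sS] ->.
  by rewrite dotBr subr_lt0 aS.
exists G; split=> // g gG.
have [s sS gE] : exists2 s, s \in S & g = s - v.
  by have /mapP[s] := sub g gG; rewrite mem_filter => /andP[_ sS] ->; exists s.
have [gcone|[f [fG fg]]] := farkas [seq r <- G | r != g] g.
  exfalso; apply: (minG g gG) => r /GS; apply: conic_min => [|||h hG].
  - exact: conic0.
  - exact: conicD.
  - exact: conicZ.
  - by have [->//|hg] := eqVneq h g; apply: conic_mem; rewrite mem_filter hg.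
have ag := aG g gG.
pose phi := f - (dot f g / dot a g) *: a.
have phig : dot phi g = 0.
  by rewrite dotBl dotZl divfK ?subrr // lt_eqF.
have phiG h : h \in G -> h != g -> dot phi h < 0.
  move=> hG hg; rewrite dotBl dotZl.
  have fh : dot f h <= 0 by apply: fG; rewrite mem_filter hg.
  have : dot f g / dot a g < 0 by rewrite pmulr_rlt0 // invr_lt0.
  have := aG h hG; nra.
pose K y := dot phi y < 0 \/ exists r, y = r *: g.
have Kle y : K y -> dot phi y <= 0.
  by move=> [/ltW //|[r ->]]; rewrite dotZr phig mulr0.
have K0 : K 0 by right; exists 0; rewrite scale0r.
have KD x y : K x -> K y -> K (x + y).
  move=> Kx Ky; have := Kle _ Kx; have := Kle _ Ky.
  case: Kx Ky => [hx|[r ->]] [hy|[q ->]]; rewrite /K !dotr ?phig ?mulr0; try by left;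
    lra.
  by move=> *; right; exists (r + q); rewrite scalerDl.
have KZ t x : 0 <= t -> K x -> K (t *: x).
  rewrite le_eqVlt => /orP[/eqP<- _|t0 [hx|[r ->]]]; first by rewrite scale0r.
    by left; rewrite dotZr; nra.
  by right; exists (t * r); rewrite scalerA.
have KG : {in G, forall h, K h}.
  move=> h hG; have [->|hg] := eqVneq h g; first by right; exists 1; rewrite scale1r.
  by left; exact: phiG.
have PK x : P x -> K (x - v).
  rewrite PS; move: x; apply: (@hull_min _ _ _ [set x | K (x - v)]).
    exact: cone_cvx.
  by move=> r rS /=; apply: conic_min (GS r rS).
have [k [w [k0 wprim gw]]] : exists k w, [/\ (0 < k)%N, primitive w & g = w *+ k].
  apply: lattice_primitive; first by rewrite gE; apply: latticeB; exact: SZ.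
  by apply: contraTneq fg => ->; rewrite dot0r ltxx.
exists k, w; split=> //; split=> //.
pose F := P `&` [set x | (phi *m x^T) 0 0 = dot phi v].
have Fv : F v by split=> //; rewrite PS; exact: hull_mem.
have Fvg : F (v + g).
  split; first by rewrite gE addrC subrK PS; exact: hull_mem.
  by rewrite /= -/(dot _ _) dotDr phig addr0.
have Fline x : F x -> exists r, x = v + r *: g.
  move=> [/PK [lt0|[r xr]] /= fx]; last by exists r; rewrite -xr addrC subrK.
  by move: lt0; rewrite dotBr /dot fx subrr ltxx.
exists F; split=> //; last first.
  by exists k%:R; [rewrite ltr0n | rewrite scaler_nat -gw].
split.
  exists phi, (dot phi v); split=> // x /PK/Kle; rewrite -/(dot _ _) dotBr; lra.
exists v, <[g]>%VS; split; last first.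
  by rewrite dim_vline; case: eqP fg => // ->; rewrite dot0r ltxx.
apply/seteqP; split=> [x [n [p [c [Fp c1 ->]]]]|x [_ /= /vlineP[r ->] <-]].
  have /choice[r pr] : forall i, exists r, p i = v + r *: g by move=> i; apply/Fline.
  exists ((\sum_i c i * r i) *: g); first by apply/vlineP; eexists.
  rewrite [RHS](eq_bigr (fun i => c i *: v + (c i * r i) *: g)); last first.
    by move=> i _; rewrite pr scalerDr scalerA.
  by rewrite big_split /= -!scaler_suml c1 scale1r.
exists 2%N, (fun i => if i == 0 then v else v + g),
  (fun i => if i == 0 then 1 - r else r).
split=> [i||]; first by case: ifP.
  by rewrite !big_ord_recl big_ord0 /=; ring.
by rewrite !big_ord_recl big_ord0 /=; apply/rowP => i; rewrite !mxE; ring.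
Qed.

End Vertices.

Section SmoothVertices.
Variables (R : realType) (d : nat).
Local Notation V := 'rV[R]_d.
Implicit Types (P K : set V) (a f g s v x y : V) (t : R) (S : seq V).

Lemma affine_hull_full P : has_dim P d -> affine_hull P = setT.
Proof.
move=> [v [U [-> dimU]]]; apply/seteqP; split=> // x _.
have -> : U = fullv.
  by apply/eqP; rewrite eqEdim subvf dimvf dimU /dim /= mul1n.
by exists (x - v); [rewrite /= memvf | rewrite addrC subrK].
Qed.

Record dual_bases (e u : 'I_d -> V) : Prop := DualBases {
  dual_lattice : forall i, lattice_points (e i);
  dual_integral : forall i, lattice_points (u i);
  dual_pairing : forall i j, dot (u i) (e j) = (i == j)%:R;
  dual_expansion : forall x, x = \sum_i dot (u i) x *: e i }.

Lemma lattice_basis_dual (B : set V) : lattice_basis (@lattice_points R d) B ->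
  exists e u, B = range e /\ dual_bases e u.
Proof.
move=> [m [b [-> BL bE]]].
have bZ i : lattice_points (b i) by apply: BL; exists i.
pose Bm := \matrix_i b i.
have mulB (c : {ffun 'I_m -> int}) : \sum_i b i *~ c i = (\row_i (c i)%:~R) *m Bm.
  rewrite mulmx_sum_row; apply: eq_bigr => i _.
  by rewrite mxE rowK scaler_int.
have deltaZ (j : 'I_d) : lattice_points (delta_mx 0 j : V).
  by apply/mxOverP => i k; rewrite mxE; case: (_ && _); rewrite ?rpred1 ?rpred0.
have /choice[c cE] : forall j : 'I_d, exists c : {ffun 'I_m -> int},
    delta_mx 0 j = \sum_i b i *~ c i.
  by move=> j; have [c [h _]] := bE _ (deltaZ j); exists c.
pose C : 'M[R]_(d, m) := \matrix_(j, i) (c j i)%:~R.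
have CB : C *m Bm = 1%:M.
  apply/row_matrixP => j; rewrite row_mul row1 cE mulB; congr (_ *m _).
  by apply/rowP => i; rewrite !mxE.
have BC : Bm *m C = 1%:M.
  apply/row_matrixP => i; rewrite row_mul rowK row1.
  have [c0 [_ uniq]] := bE _ (bZ i).
  pose c1 : {ffun 'I_m -> int} := [ffun k => (i == k)%:Z].
  have [c2 c2E] : exists c2 : {ffun 'I_m -> int}, \row_k (c2 k)%:~R = b i *m C.
    have /choice[z zE] : forall k, exists z : int, (b i *m C) 0 k = z%:~R.
      move=> k; apply/intrP; rewrite mxE; apply: rpred_sum => j _.
      have /mxOverP biZ := bZ i.
      by rewrite rpredM // mxE intr_int.
    by exists [ffun k => z k]; apply/rowP => k; rewrite mxE ffunE zE.
  have c1E : \row_k (c1 k)%:~R = delta_mx 0 i :> 'rV[R]_m.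
    by apply/rowP => k; rewrite !mxE ffunE eqxx /= eq_sym; case: (_ == _).
  rewrite -c2E -c1E -(uniq c1) ?(uniq c2) //.
    by rewrite mulB c2E -mulmxA CB mulmx1.
  by rewrite mulB c1E -rowE rowK.
have /eqP dm : d == m by rewrite eqn_leq (mulmx1_min CB) (mulmx1_min BC).
subst m.
exists b, (fun i => (col i C)^T); split=> //.
have dotE i x : dot (col i C)^T x = (x *m C) 0 i.
  by rewrite dotC /dot trmxK !mxE; apply: eq_bigr => j _; rewrite mxE.
split=> // [i|i j|x].
- by apply/mxOverP => k l; rewrite !mxE intr_int.
- by rewrite dotE -[b j](rowK b) -row_mul BC mxE eq_sym mxE.
- rewrite -{1}[x]mulmx1 -CB mulmxA mulmx_sum_row; apply: eq_bigr => i _.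
  by rewrite dotE rowK.
Qed.

Record smooth_vertex P v (e u : 'I_d -> V) : Prop := SmoothVertex {
  sv_dual :> dual_bases e u;
  sv_edge : forall i, P (v + e i);
  sv_cone : forall i x, P x -> 0 <= dot (u i) (x - v) }.

Lemma smooth_vertices P : lattice_polytope P -> has_dim P d -> smooth P ->
  exists S, [/\ {in S, forall s, lattice_points s}, P = convex_hull [set` S] &
    {in S, forall v, exists e u, smooth_vertex P v e u}].
Proof.
move=> latP dimP [_ smP].
have [S [SZ PS Svert]] := polytope_vertices latP.
exists S; split=> // v vS; have [a Pv aS] := Svert v vS.
have vZ := SZ v vS.
have := smP v Pv; rewrite affine_hull_full // setTI.
have -> : [set x - v | x in @lattice_points R d] = @lattice_points R d.
  apply/seteqP; split=> [_ [x xZ <-]|x xZ]; first exact: latticeB.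
  by exists (x + v); [exact: latticeD | rewrite addrK].
move=> /lattice_basis_dual[e [u [dirE eu]]]; exists e, u.
have [G [SG GE]] := edge_generators PS SZ vS (ex_intro _ a aS).
have cone i : forall x, P x -> 0 <= dot (u i) (x - v).
  move=> x; rewrite PS => Px.
  suff : dot (- u i) x <= dot (- u i) v by rewrite !dotNl dotBr; lra.
  apply: hull_le Px => s /SG sG; suff : 0 <= dot (u i) (s - v) by rewrite !dotNl
    dotBr; lra.
  apply: (@conic_min _ _ (fun y => 0 <= dot (u i) y)) sG => [|y z hy hz|t y t0 hy|g
    /GE].
  - by rewrite dot0r.
  - by rewrite dotDr addr_ge0.
  - by rewrite dotZr mulr_ge0.
  - move=> [k [w [_]]]; rewrite dirE => -[j _ <-] ->.
    by rewrite -scaler_nat dotZr (dual_pairing eu) mulr_ge0.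
split=> // i.
have : range e (e i) by exists i.
rewrite -dirE => -[_ [_ [[[f [c [_ ->]]] _] _ [t t0 [Pt _]]]]].
have [s sS [s0 si]] : exists2 s, s \in S &
    (forall j, j != i -> dot (u j) (s - v) = 0) /\ dot (u i) (s - v) != 0.
  apply: contrapT => none.
  pose K y := (forall j, 0 <= dot (u j) y) /\
    ((forall j, j != i -> dot (u j) y = 0) -> dot (u i) y = 0).
  have KZ c' y : 0 <= c' -> K y -> K (c' *: y).
    rewrite le_eqVlt => /orP[/eqP<- _|c0 [hy1 hy2]].
      by rewrite scale0r; split=> [j|_]; rewrite dot0r.
    split=> [j|h]; first by rewrite dotZr mulr_ge0 // ltW.
    rewrite dotZr hy2 ?mulr0 // => j /h/eqP.
    by rewrite dotZr mulf_eq0 gt_eqF //= => /eqP.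
  have KD x y : K x -> K y -> K (x + y).
    move=> [hx1 hx2] [hy1 hy2]; split=> [j|h]; first by rewrite dotDr addr_ge0.
    rewrite dotDr hx2 ?hy2 ?addr0 // => j /h; rewrite dotDr.
      by have := hx1 j; have := hy1 j; lra.
    by have := hx1 j; have := hy1 j; lra.
  have : K (v + t *: e i - v).
    move: Pt; rewrite PS; apply: (@hull_min _ _ _ [set x | K (x - v)]).
      exact: cone_cvx.
    move=> s sS; split=> [j|h]; first by apply: cone; rewrite PS; exact: hull_mem.
    by apply: contrapT => /eqP hi; apply: none; exists s.
  rewrite addrC addKr => -[_]; rewrite dotZr (dual_pairing eu) eqxx mulr1 => h;
    move: t0.
  by rewrite h ?ltxx // => j ji; rewrite dotZr (dual_pairing eu) (negbTE ji) mulr0.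
have r1 : 1 <= dot (u i) (s - v).
  apply: int_gt0; first by apply: dot_int;
    [exact: dual_integral eu i | apply: latticeB; first exact: SZ].
  by rewrite lt_neqAle eq_sym si cone // PS; exact: hull_mem.
have sE : s - v = dot (u i) (s - v) *: e i.
  rewrite {1}(dual_expansion eu (s - v)) (bigD1 i) //= big1 ?addr0 // => j ji.
  by rewrite s0 // scale0r.
move: (dot _ _) r1 sE {s0 si} => r r1 sE.
have rn0 : r != 0 by rewrite gt_eqF //; lra.
have -> : v + e i = r^-1 *: s + (1 - r^-1) *: v.
  have -> : s = v + r *: e i by rewrite -sE addrC subrK.
  by apply/rowP => j; rewrite !mxE; field.
rewrite PS; apply: hull_cvx; rewrite ?invr_ge0 ?invf_le1 //; [lra|lra| |];
  exact: hull_mem.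
Qed.

End SmoothVertices.

(** * Decomposing lattice points in parallelepipeds and wedges *)

Section Decompositions.
Variables (R : realType) (d : nat).
Local Notation V := 'rV[R]_d.
Variable P : set V.
Hypothesis Pcvx : cvx P.
Implicit Types (a b c f o p q : V) (s t : R) (n : nat).

Definition decomposes n p := exists q : 'I_n -> V,
  (forall i, P (q i) /\ lattice_points (q i)) /\ p = \sum_i q i.

Lemma decomposes0 : decomposes 0 0.
Proof. by exists (fun=> 0); split=> [[]|] //; rewrite big_ord0. Qed.

Lemma decomposesS n p q : P q -> lattice_points q ->
  decomposes n (p - q) -> decomposes n.+1 p.
Proof.
move=> Pq qZ [r [rP pq]]; exists (fun i => if unlift ord0 i is Some j then r j else q).
split=> [i|]; first by case: unliftP => [j _|_]; [exact: rP | split].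
rewrite big_ord_recl unlift_none; under eq_bigr => i _ do rewrite liftK.
by rewrite -pq addrC subrK.
Qed.

Lemma cvx_seg f o t : 0 <= t -> t <= 1 -> P o -> P (o + f) -> P (o + t *: f).
Proof.
move=> t0 t1 Po Pf; have := Pcvx t0 t1 Pf Po; congr P.
by apply/rowP => i; rewrite !mxE; ring.
Qed.

Lemma cvx3 a b c (x y z : R) : 0 <= x -> 0 <= y -> 0 <= z -> x + y + z = 1 ->
  P a -> P b -> P c -> P (x *: a + y *: b + z *: c).
Proof.
move=> x0 y0 z0 s1 Pa Pb Pc; have [xy|xy] := eqVneq (x + y) 0.
  have [-> ->] : x = 0 /\ y = 0 by split; lra.
  have -> : z = 1 by lra.
  by rewrite !scale0r !add0r scale1r.
have xy0 : 0 < x + y by rewrite lt_neqAle eq_sym xy addr_ge0.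
have Pab : P ((x / (x + y)) *: a + (1 - x / (x + y)) *: b).
  apply: Pcvx => //; first by apply: divr_ge0 => //; exact: ltW.
  by rewrite ler_pdivrMr // mul1r lerDl.
have xy1 : x + y <= 1 by lra.
have := Pcvx (ltW xy0) xy1 Pab Pc.
congr P; have -> : z = 1 - (x + y) by lra.
by apply/rowP => i; rewrite !mxE; field.
Qed.

Lemma box_decomposes n o f1 f2 f3 s1 s2 s3 :
  (forall e1 e2 e3 : bool, P (o + e1%:R *: f1 + e2%:R *: f2 + e3%:R *: f3)) ->
  lattice_points o -> lattice_points f1 -> lattice_points f2 -> lattice_points f3 ->
  let p := n%:R *: o + s1 *: f1 + s2 *: f2 + s3 *: f3 in
  lattice_points p -> 0 <= s1 <= n%:R -> 0 <= s2 <= n%:R -> 0 <= s3 <= n%:R ->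
  (0 < n)%N -> decomposes n p.
Proof.
move=> box oZ f1Z f2Z f3Z; elim: n s1 s2 s3 => // n IH s1 s2 s3 /= pZ.
move=> /andP[s10 s1n] /andP[s20 s2n] /andP[s30 s3n] _.
have [n0|n0] := posnP n.
  subst n; have Pp : P (o + s1 *: f1 + s2 *: f2 + s3 *: f3).
    have line (e1 e2 : bool) : P (o + e1%:R *: f1 + e2%:R *: f2 + s3 *: f3).
      apply: cvx_seg => //.
        by have := box e1 e2 false; rewrite [false%:R *: _]scale0r addr0.
      by have := box e1 e2 true; rewrite [true%:R *: _]scale1r.
    have face (e1 : bool) : P (o + e1%:R *: f1 + s2 *: f2 + s3 *: f3).
      rewrite addrAC; apply: cvx_seg => //.
        by have := line e1 false; rewrite [false%:R *: _]scale0r addr0.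
      by have := line e1 true; rewrite [true%:R *: _]scale1r addrAC.
    suff : P (o + s2 *: f2 + s3 *: f3 + s1 *: f1) by congr P; rewrite -!addrA;
      congr (_ + _); rewrite addrA addrC.
    apply: cvx_seg => //.
      by have := face false; rewrite [false%:R *: _]scale0r addr0.
    have := face true; rewrite [true%:R *: _]scale1r; congr P.
    by rewrite -!addrA; congr (_ + _); rewrite addrC -addrA.
  apply: (@decomposesS 0 _ (1 *: o + s1 *: f1 + s2 *: f2 + s3 *: f3)) => //.
    by rewrite scale1r.
  rewrite subrr; exact: decomposes0.
have n1 : 1 <= n%:R :> R by rewrite ler1n.
have bnd s : 0 <= s -> s <= n.+1%:R -> 0 <= s - (1 <= s)%R%:R <= n%:R.
  rewrite -natr1 => h0 h1; case: (lerP 1 s) => /= h; apply/andP; split; lra.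
have boolZ (b : bool) : b%:R \is a @Num.int R by case: b.
pose r := o + (1 <= s1)%R%:R *: f1 + (1 <= s2)%R%:R *: f2 + (1 <= s3)%R%:R *: f3.
have rZ : lattice_points r by do 3! apply: latticeDZ => //.
set q := (X in lattice_points X) in pZ *.
apply: (@decomposesS n _ r) => //; first exact: box.
have qrE : q - r = n%:R *: o + (s1 - (1 <= s1)%R%:R) *: f1 +
    (s2 - (1 <= s2)%R%:R) *: f2 + (s3 - (1 <= s3)%R%:R) *: f3.
  by rewrite /q /r -natr1; apply/rowP => i; rewrite !mxE; ring.
rewrite qrE; apply: IH => //; try exact: bnd.
by rewrite -qrE; exact: latticeB.
Qed.

Hypothesis Psym : forall x, P x -> P (- x).

Lemma cvx_sym0 a : P a -> P 0.
Proof.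
move=> Pa; have := Pcvx _ _ Pa (Psym Pa) => /(_ 2^-1).
rewrite (_ : _ + _ = 0); first by apply; lra.
by apply/rowP => i; rewrite !mxE; field.
Qed.

(* conv(Q, -Q) is a parallelepiped whenever Q is a parallelogram. *)
Lemma parallelogram_decomposes n a b c s t u :
  P a -> P b -> P c -> P (b + c - a) ->
  lattice_points a -> lattice_points b -> lattice_points c ->
  let p := u *: (a + s *: (b - a) + t *: (c - a)) in
  lattice_points p -> 0 <= u <= n%:R -> 0 <= s <= 1 -> 0 <= t <= 1 ->
  (0 < n)%N -> decomposes n p.
Proof.
move=> Pa Pb Pc Pd aZ bZ cZ p pZ /andP[u0 un] /andP[s0 s1] /andP[t0 t1] n0.
have pE : p = n%:R *: (a - b - c) + (u * s + (n%:R - u) / 2) *: (b - a) +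
    (u * t + (n%:R - u) / 2) *: (c - a) + ((u + n%:R) / 2) *: (b + c).
  by apply/rowP => i; rewrite !mxE; field.
rewrite pE; apply: box_decomposes => //.
- move=> e1 e2 e3.
  have := Psym Pa; have := Psym Pb; have := Psym Pc; have := Psym Pd.
  move: Pa Pb Pc Pd; case: e1; case: e2; case: e3 => /=;
    rewrite ?scale1r ?scale0r => h1 h2 h3 h4 h5 h6 h7 h8;
    [move: h4|move: h8|move: h2|move: h6|move: h3|move: h7|move: h1|move: h5];
      congr P; try exact: erefl;
    apply/rowP => i; rewrite !mxE; ring.
- by apply: latticeB => //; apply: latticeB.
- exact: latticeB.
- exact: latticeB.
- exact: latticeD.
- by rewrite -pE.
- by apply/andP; split; nra.
- by apply/andP; split; nra.
- by apply/andP; split; lra.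
Qed.

End Decompositions.

Section Wedges.
Variables (R : realType) (d : nat).
Local Notation V := 'rV[R]_d.
Variable P : set V.
Hypothesis Pcvx : cvx P.
Implicit Types (a b c e f o p q : V) (s t u x y : R) (n : nat).

Lemma wedge_decomposes n a f1 f2 e (k : R) x y z :
  k \is a Num.int -> 0 < k ->
  P a -> P (a + f1) -> P (a + f2) ->
  P (a + e) -> P (a + e + k *: f1) -> P (a + e + k *: f2) ->
  lattice_points a -> lattice_points f1 -> lattice_points f2 -> lattice_points e ->
  x \is a Num.int -> y \is a Num.int -> z \is a Num.int ->
  0 <= x -> 0 <= y -> 0 <= z <= n%:R -> x + y <= n%:R + (k - 1) * z ->
  decomposes P n (n%:R *: a + x *: f1 + y *: f2 + z *: e).
Proof.
move=> kZ k0 Pa Pa1 Pa2 Pe Pe1 Pe2 aZ f1Z f2Z eZ.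
elim: n x y z => [|n IH] x y z xZ yZ zZ x0 y0 /andP[z0 zn] xy.
  have -> : z = 0 by apply/eqP; rewrite eq_le z0 zn.
  have [-> ->] : x = 0 /\ y = 0 by split; nra.
  by rewrite !scale0r !addr0; exact: decomposes0.
rewrite -natr1 in zn xy *.
have split1 (m : R) : m \is a Num.int -> 0 < m -> exists x1 y1,
    [/\ x1 \is a Num.int, y1 \is a Num.int, 0 <= x1 <= x, 0 <= y1 <= y &
      x1 + y1 <= m /\ ((x1 = x /\ y1 = y) \/ x1 + y1 = m)].
  move=> mZ m0; have [xm|xm] := lerP m x.
    exists m, 0; split=> //; [by apply/andP; split; lra | by rewrite lexx | by split;
      [|right]; lra].
  have [xym|xym] := lerP m (x + y).
    by exists x, (m - x); split=> //; [exact: rpredB | by apply/andP; split;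
      lra | by apply/andP; split; lra | by split; [|right]; lra].
  by exists x, y; split=> //; [by apply/andP; split; lra | by apply/andP; split;
    lra | by split; [lra | left]].
have [zpos|znpos] := ltrP 0 z.
- have z1 := int_gt0 zZ zpos.
  have [x1 [y1 [x1Z y1Z /andP[x10 x1x] /andP[y10 y1y] [s1 s2]]]] := split1 k kZ k0.
  apply: (@decomposesS _ _ _ _ _ (a + e + x1 *: f1 + y1 *: f2)).
  + have kn0 : k != 0 by rewrite gt_eqF.
    have -> : a + e + x1 *: f1 + y1 *: f2 = (1 - x1 / k - y1 / k) *: (a + e) +
        (x1 / k) *: (a + e + k *: f1) + (y1 / k) *: (a + e + k *: f2).
      by apply/rowP => i; rewrite !mxE; field.
    apply: cvx3 => //; [|by rewrite divr_ge0 // ltW|by rewrite divr_ge0 // ltW|lra].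
    rewrite -addrA -opprD subr_ge0 -mulrDl ler_pdivrMr // mul1r; exact: s1.
  + by do 2! apply: latticeDZ => //; apply: latticeD.
  have -> : (n%:R + 1) *: a + x *: f1 + y *: f2 + z *: e - (a + e + x1 *: f1 + y1 *:
    f2) =
      n%:R *: a + (x - x1) *: f1 + (y - y1) *: f2 + (z - 1) *: e.
    by apply/rowP => i; rewrite !mxE; ring.
  apply: IH; rewrite ?rpredB ?rpred1 ?subr_ge0 //; [apply/andP; split; lra|].
  have : 0 <= (n%:R : R) by [].
  case: s2 => [[-> ->]|s2] n0; [nra|nra].
- have z00 : z = 0 by apply/eqP; rewrite eq_le z0 znpos.
  subst z; have [x1 [y1 [x1Z y1Z /andP[x10 x1x] /andP[y10 y1y] [s1 s2]]]] :=
    split1 1 (rpred1 _) ltr01.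
  apply: (@decomposesS _ _ _ _ _ (a + x1 *: f1 + y1 *: f2)).
  + have -> : a + x1 *: f1 + y1 *: f2 = (1 - x1 - y1) *: a +
        x1 *: (a + f1) + y1 *: (a + f2).
      by apply/rowP => i; rewrite !mxE; ring.
    by apply: cvx3 => //; lra.
  + by do 2! apply: latticeDZ => //.
  have -> : (n%:R + 1) *: a + x *: f1 + y *: f2 + 0 *: e - (a + x1 *: f1 + y1 *: f2) =
      n%:R *: a + (x - x1) *: f1 + (y - y1) *: f2 + 0 *: e.
    by apply/rowP => i; rewrite !mxE; ring.
  apply: IH; rewrite ?rpredB ?rpred0 ?subr_ge0 //; first by rewrite lexx /=.
  have : 0 <= (n%:R : R) by [].
  by case: s2 => [[-> ->]|s2] n0; lra.
Qed.

Hypothesis Psym : forall p, P p -> P (- p).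

Lemma int_ceil x : exists2 r : R, r \is a Num.int & x <= r < x + 1.
Proof.
exists (Num.ceil x)%:~R; first exact: intr_int.
by have /andP[] := ceil_itv x; rewrite intrB => h1 h2; apply/andP; split; lra.
Qed.

Lemma corner_decomposes n a f1 f2 (k : R) x y u r s :
  P a -> P (a + k *: f1) -> P (a + k *: f2) ->
  lattice_points a -> lattice_points f1 -> lattice_points f2 ->
  r \is a Num.int -> s \is a Num.int -> 0 <= x <= r -> 0 <= y <= s -> r + s <= k ->
  lattice_points (u *: (a + x *: f1 + y *: f2)) -> 0 <= u <= n%:R -> (0 < n)%N ->
  decomposes P n (u *: (a + x *: f1 + y *: f2)).
Proof.
move=> Pa Pa1 Pa2 aZ f1Z f2Z rZ sZ /andP[x0 xr] /andP[y0 ys] rsk.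
have divK (v w : R) : 0 <= v -> v <= w -> v = v / w * w /\ 0 <= v / w <= 1.
  move=> v0 vw; have [w0|w0] := eqVneq w 0.
    have -> : v = 0 by apply/eqP; rewrite eq_le v0 -w0 vw.
    by rewrite !mul0r lexx ler01.
  have wpos : 0 < w by rewrite lt_neqAle eq_sym w0 (le_trans v0).
  by rewrite divfK // divr_ge0 ?(ltW wpos) //= ler_pdivrMr // mul1r.
have [xE x1] := divK x r x0 xr; have [yE y1] := divK y s y0 ys.
have pE : a + x *: f1 + y *: f2 =
    a + (x / r) *: (a + r *: f1 - a) + (y / s) *: (a + s *: f2 - a).
  by rewrite ![a + _ - a]addrAC subrr !add0r !scalerA -xE -yE.
rewrite pE; have mem (v w : R) : 0 <= v -> 0 <= w -> v + w <= k ->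
  P (a + v *: f1 + w *: f2).
  move=> v0 w0 vwk; have [k0|k0] := eqVneq k 0.
    have [-> ->] : v = 0 /\ w = 0 by split; lra.
    by rewrite !scale0r !addr0.
  have kpos : 0 < k by rewrite lt_neqAle eq_sym k0 (le_trans _ vwk) ?addr_ge0.
  have -> : a + v *: f1 + w *: f2 = (1 - v / k - w / k) *: a +
      (v / k) *: (a + k *: f1) + (w / k) *: (a + k *: f2).
    by apply/rowP => i; rewrite !mxE; field.
  apply: cvx3 => //; [|by rewrite divr_ge0 // ltW|by rewrite divr_ge0 // ltW|lra].
  by rewrite -addrA -opprD subr_ge0 -mulrDl ler_pdivrMr // mul1r.
move=> pZ un n0; apply: (parallelogram_decomposes Pcvx Psym (a := a) (b :=
  a + r *: f1) (c := a + s *: f2)) => //.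
- by have := mem r 0; rewrite scale0r !addr0; apply; lra.
- by have := mem 0 s; rewrite scale0r addr0 add0r; apply; lra.
- have := mem r s; rewrite (_ : a + r *: f1 + (a + s *: f2) - a = a + r *: f1 + s *:
  f2).
    by apply; lra.
  by apply/rowP => i; rewrite !mxE; ring.
- by apply: latticeD => //; apply: latticeZ.
- by apply: latticeD => //; apply: latticeZ.
Qed.

(* Among the three corners of the triangle k*Delta with k >= 2,
  at least one is joined to
   the point by a lattice parallelogram along the sides: otherwise the roundings up
   of the barycentric coordinates, which sum to less than k + 3, sum to at least
   3(k + 1)/2. *)
Lemma triangle_decomposes n a f1 f2 (k : R) x y u :
  k \is a Num.int -> 1 < k ->
  P a -> P (a + k *: f1) -> P (a + k *: f2) ->
  lattice_points a -> lattice_points f1 -> lattice_points f2 ->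
  0 <= x -> 0 <= y -> x + y <= k ->
  lattice_points (u *: (a + x *: f1 + y *: f2)) -> 0 <= u <= n%:R -> (0 < n)%N ->
  decomposes P n (u *: (a + x *: f1 + y *: f2)).
Proof.
move=> kZ k1 Pa Pa1 Pa2 aZ f1Z f2Z x0 y0 xyk pZ un n0.
pose z := k - x - y; have z0 : 0 <= z by rewrite /z; lra.
have [r rZ /andP[xr rx]] := int_ceil x.
have [s sZ /andP[ys sy]] := int_ceil y.
have [q qZ /andP[zq qz]] := int_ceil z.
have [rs|rs] := lerP (r + s) k.
  by apply: (@corner_decomposes n a f1 f2 k x y u r s) => //; apply/andP.
have [qs|qs] := lerP (q + s) k.
  have pE : a + x *: f1 + y *: f2 = a + k *: f1 + z *: (- f1) + y *: (f2 - f1).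
    by rewrite /z; apply/rowP => i; rewrite !mxE; ring.
  rewrite pE; apply: (@corner_decomposes n _ _ _ k z y u q s) => //; rewrite -?pE //.
  - by move: Pa; congr P; apply/rowP => i; rewrite !mxE; ring.
  - by move: Pa2; congr P; apply/rowP => i; rewrite !mxE; ring.
  - by apply: latticeD => //; apply: latticeZ.
  - exact: latticeN.
  - exact: latticeB.
  - exact/andP.
  - exact/andP.
have [qr|qr] := lerP (r + q) k.
  have pE : a + x *: f1 + y *: f2 = a + k *: f2 + x *: (f1 - f2) + z *: (- f2).
    by rewrite /z; apply/rowP => i; rewrite !mxE; ring.
  rewrite pE; apply: (@corner_decomposes n _ _ _ k x z u r q) => //; rewrite -?pE //.
  - by move: Pa1; congr P; apply/rowP => i; rewrite !mxE; ring.
  - by move: Pa; congr P; apply/rowP => i; rewrite !mxE; ring.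
  - by apply: latticeD => //; apply: latticeZ.
  - exact: latticeB.
  - exact: latticeN.
  - exact/andP.
  - exact/andP.
have := int_ltD1 kZ (rpredD rZ sZ) rs.
have := int_ltD1 kZ (rpredD qZ sZ) qs.
have := int_ltD1 kZ (rpredD rZ qZ) qr.
have h : r + s + q < k + 3 by move: qz; rewrite /z; lra.
have := int_ltD1 (rpredD (rpredD rZ sZ) qZ) (rpredD kZ (rpred_nat _ 3)) h.
lra.
Qed.

End Wedges.

(** * Lattice triangles in a facet *)

Section Det3.
Variable R : realType.
Local Notation V := 'rV[R]_3.
Implicit Types (a b c p q : V).

Let i0 : 'I_3 := ord0.
Let i1 : 'I_3 := lift ord0 ord0.
Let i2 : 'I_3 := lift ord0 (lift ord0 ord0).

Lemma row3P (x y : V) :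
  x 0 i0 = y 0 i0 -> x 0 i1 = y 0 i1 -> x 0 i2 = y 0 i2 -> x = y.
Proof.
move=> h0 h1 h2; apply/rowP => -[[|[|[|//]]] Hi].
- by rewrite (_ : Ordinal Hi = i0) //; exact: val_inj.
- by rewrite (_ : Ordinal Hi = i1) //; exact: val_inj.
- by rewrite (_ : Ordinal Hi = i2) //; exact: val_inj.
Qed.

Lemma dot3E (x y : V) : dot x y = x 0 i0 * y 0 i0 + x 0 i1 * y 0 i1 + x 0 i2 * y 0 i2.
Proof. by rewrite dotE !big_ord_recl big_ord0 addr0 addrA. Qed.

Definition cross a b : V := \row_i
  if i == i0 then a 0 i1 * b 0 i2 - a 0 i2 * b 0 i1
  else if i == i1 then a 0 i2 * b 0 i0 - a 0 i0 * b 0 i2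
  else a 0 i0 * b 0 i1 - a 0 i1 * b 0 i0.

Definition det3 a b c := dot a (cross b c).

Lemma det3E a b c : det3 a b c =
  a 0 i0 * (b 0 i1 * c 0 i2 - b 0 i2 * c 0 i1) +
  a 0 i1 * (b 0 i2 * c 0 i0 - b 0 i0 * c 0 i2) +
  a 0 i2 * (b 0 i0 * c 0 i1 - b 0 i1 * c 0 i0).
Proof. by rewrite /det3 dot3E !mxE. Qed.

Lemma det3_rot a b c : det3 b c a = det3 a b c.
Proof. by rewrite !det3E; ring. Qed.

Lemma det3_combl a b c (x y z : R) :
  det3 (x *: a + y *: b + z *: c) b c = x * det3 a b c.
Proof. by rewrite !det3E !mxE; ring. Qed.

Lemma det3_int a b c : lattice_points a -> lattice_points b -> lattice_points c ->
  det3 a b c \is a Num.int.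
Proof.
move=> /mxOverP aZ /mxOverP bZ /mxOverP cZ; rewrite det3E.
by rewrite !(rpredD, rpredN, rpredM).
Qed.

Lemma cramer3 a b c p : det3 a b c != 0 ->
  p = (det3 p b c / det3 a b c) *: a + (det3 p c a / det3 a b c) *: b +
      (det3 p a b / det3 a b c) *: c.
Proof.
move=> D; apply: (scalerI D).
rewrite !scalerDr !scalerA ![det3 a b c * _]mulrC !divfK //.
by rewrite !det3E; apply: row3P; rewrite !mxE; ring.
Qed.

(* The right-hand side is the determinant of the matrix of scalar products. *)
Lemma det3_gram a b c (x y z : V) : det3 a b c * det3 x y z =
  dot x a * (dot y b * dot z c - dot z b * dot y c) +
  dot y a * (dot z b * dot x c - dot x b * dot z c) +
  dot z a * (dot x b * dot y c - dot y b * dot x c).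
Proof. by rewrite !det3E !dot3E; ring. Qed.

Lemma conic3P a b c p : conic [:: a; b; c] p <->
  exists l m n, [/\ 0 <= l, 0 <= m, 0 <= n & p = l *: a + m *: b + n *: c].
Proof.
split=> [/= [l l0 [m m0 [n n0 /eqP]]]|[l [m [n [l0 m0 n0 ->]]]]].
  by rewrite !subr_eq add0r => /eqP->; exists l, m, n; split=> //;
    rewrite addrC [X in _ + X]addrC addrA.
by apply: conicD; [apply: conicD|]; apply: conicZ => //; apply: conic_mem;
  rewrite !inE eqxx ?orbT.
Qed.

End Det3.

Section Pivot.
Variable R : realType.
Local Notation V := 'rV[R]_3.
Implicit Types (a b c p q : V).

Lemma min_ratio (l m n x y z : R) : 0 <= l -> 0 <= m -> 0 <= n ->
  [\/ 0 < x, 0 < y | 0 < z] ->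
  [\/ [/\ 0 < x, l / x * y <= m & l / x * z <= n],
      [/\ 0 < y, m / y * z <= n & m / y * x <= l] |
      [/\ 0 < z, n / z * x <= l & n / z * y <= m]].
Proof.
move=> l0 m0 n0 pos.
pose L (i : 'I_3) := [:: l; m; n]`_i; pose X (i : 'I_3) := [:: x; y; z]`_i.
have L0 i : 0 <= L i by case: i => -[|[|[|]]].
have [k Xk] : exists k, 0 < X k.
  by case: pos => h; [exists (inord 0) | exists (inord 1) | exists (inord 2)];
    rewrite /X inordK.
have [i Xi imin] := @arg_minP _ R _ k (fun i => 0 < X i) (fun i => L i / X i) Xk.
have ratio j : L i / X i * X j <= L j.
  have [Xj|Xj] := ltrP 0 (X j); last first.
    by apply: le_trans (L0 j); rewrite mulr_ge0_le0 // divr_ge0 // ltW.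
  by rewrite -ler_pdivlMr //; exact: imin.
have := ratio (inord 0); have := ratio (inord 1); have := ratio (inord 2).
rewrite /L /X !inordK //=; move: Xi; rewrite /X /L.
by case: i {imin ratio} => -[|[|[|//]]] _ /= *; [apply: Or31|apply: Or32|apply: Or33].
Qed.

Lemma pivot a b c p q (x y z : R) : q = x *: a + y *: b + z *: c ->
  conic [:: a; b; c] p -> [\/ 0 < x, 0 < y | 0 < z] ->
  exists t b' c' k, [/\ 0 <= t, b' \in [:: a; b; c], c' \in [:: a; b; c],
    conic [:: b'; c'] (p - t *: q) & [/\ 0 < k, k \in [:: x; y; z] &
    det3 q b' c' = k * det3 a b c]].
Proof.
have main a' b' c' (l m n x' y' z' : R) : 0 <= l ->
  q = x' *: a' + y' *: b' + z' *: c' ->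
    p = l *: a' + m *: b' + n *: c' -> 0 < x' -> l / x' * y' <= m -> l / x' * z' <= n ->
    [/\ 0 <= l / x', conic [:: b'; c'] (p - (l / x') *: q) &
     det3 q b' c' = x' * det3 a' b' c'].
  move=> l0 -> -> x0 hy hz; split; [by rewrite divr_ge0 // ltW| |exact: det3_combl].
  exists (m - l / x' * y'); first by rewrite subr_ge0.
  exists (n - l / x' * z'); first by rewrite subr_ge0.
  have xn0 : x' != 0 by rewrite gt_eqF.
  by apply/rowP => i; rewrite !mxE; field.
move=> qE /conic3P[l [m [n [l0 m0 n0 pE]]]] /(min_ratio l0 m0 n0)[] [x0 h1 h2].
- have [] := main a b c l m n x y z l0 qE pE x0 h1 h2 => t0 h3 h4.
  by exists (l / x), b, c, x; split; rewrite ?inE ?eqxx ?orbT.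
- have [||] := main b c a m n l y z x m0 _ _ x0 h1 h2.
  + by rewrite qE -addrA addrC.
  + by rewrite pE -addrA addrC.
  move=> t0 h3 h4; exists (m / y), c, a, y; split; rewrite ?inE ?eqxx ?orbT //.
  by split=> //; rewrite ?inE ?eqxx ?orbT // h4 det3_rot.
- have [||] := main c a b n l m z x y n0 _ _ x0 h1 h2.
  + by rewrite qE addrC addrA.
  + by rewrite pE addrC addrA.
  move=> t0 h3 h4; exists (n / z), a, b, z; split; rewrite ?inE ?eqxx ?orbT //.
  by split=> //; rewrite ?inE ?eqxx ?orbT // h4 -det3_rot.
Qed.

End Pivot.

Section FacetTriangles.
Variable R : realType.
Local Notation V := 'rV[R]_3.
Variables (P : set V) (w : V) (h : R).
Hypothesis Pcvx : cvx P.
Hypothesis h0 : 0 < h.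
Implicit Types (a b c m p s x : V) (L : seq V).

Definition facet x := P x /\ dot w x = h.

Record lattice_triangle a b c : Prop := LatticeTriangle {
  lt_facet : {in [:: a; b; c], forall x, facet x /\ lattice_points x};
  lt_det : det3 a b c != 0 }.

Lemma lattice_triangle_facet a b c : lattice_triangle a b c ->
  [/\ facet a, facet b & facet c].
Proof. by move=> [T _]; split; apply T; rewrite !inE eqxx ?orbT. Qed.

Lemma lattice_triangle_lattice a b c : lattice_triangle a b c ->
  [/\ lattice_points a, lattice_points b & lattice_points c].
Proof. by move=> [T _]; split; apply T; rewrite !inE eqxx ?orbT. Qed.

Lemma lattice_triangleS a b c s b' c' : lattice_triangle a b c ->
  facet s -> lattice_points s -> b' \in [:: a; b; c] -> c' \in [:: a; b; c] ->
  det3 s b' c' != 0 -> lattice_triangle s b' c'.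
Proof.
move=> [abc _] Fs sZ b'P c'P D; split=> // x; rewrite !inE.
by case/or3P => /eqP->; [split | exact: abc | exact: abc].
Qed.

Lemma caratheodory_step a b c p s (t : R) : lattice_triangle a b c ->
  facet s -> lattice_points s -> conic [:: a; b; c] (p - t *: s) -> 0 <= t ->
  exists a' b' c', lattice_triangle a' b' c' /\ conic [:: a'; b'; c'] p.
Proof.
move=> abc Fs sZ pabc t0; have D := lt_det abc.
have sE := cramer3 s D; move: sE.
set x := _ / _; set y := _ / _; set z := _ / _ => sE.
have [neg|nneg] := pselect [\/ 0 < - x, 0 < - y | 0 < - z]; last first.
  exists a, b, c; split=> //; rewrite -(subrK (t *: s) p); apply: conicD => //.
  apply: conicZ => //; apply/conic3P; exists x, y, z.
  by split=> //; rewrite leNgt -oppr_gt0; apply/negP => h1; apply: nneg;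
    [apply: Or31|apply: Or32|apply: Or33].
have NsE : - s = (- x) *: a + (- y) *: b + (- z) *: c by rewrite {1}sE !scaleNr !opprD.
have [u [b' [c' [k [u0 b'P c'P con [k0 _ dets]]]]]] := pivot NsE pabc neg.
have dets0 : det3 s b' c' != 0.
  have : det3 s b' c' = - (k * det3 a b c) by rewrite -dets /det3 dotNl opprK.
  by move=> ->; rewrite oppr_eq0 mulf_neq0 // gt_eqF.
have [ut|tu] := lerP u t.
  exists s, b', c'; split; first exact: (lattice_triangleS abc).
  exists (t - u); first by rewrite subr_ge0.
  move: con; congr (conic [:: b'; c'] _).
  by apply/rowP => i; rewrite !mxE; ring.
exists a, b, c; split=> //.
have un0 : u != 0 by rewrite gt_eqF // (le_lt_trans t0).
have -> : p = (1 - t / u) *: (p - t *: s) + (t / u) *: (p - t *: s - u *: (- s)).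
  by apply/rowP => i; rewrite !mxE; field.
have tu1 : t / u <= 1 by rewrite ler_pdivrMr ?mul1r ?(le_lt_trans t0) // ltW.
apply: conicD; apply: conicZ => //; first by rewrite subr_ge0.
  by rewrite divr_ge0 // ltW // (le_lt_trans t0).
apply: (@conic_min _ _ (conic [:: a; b; c])) con => [||v r v0|v].
- exact: conic0.
- exact: conicD.
- exact: conicZ.
- by rewrite !inE => /orP[]/eqP->; exact: conic_mem.
Qed.

Lemma caratheodory a b c L p : lattice_triangle a b c ->
  {in L, forall s, facet s /\ lattice_points s} -> conic L p ->
  exists a' b' c', lattice_triangle a' b' c' /\ conic [:: a'; b'; c'] p.
Proof.
move=> abc; elim: L p => [|s L IH] p LF.
  by move=> p0; rewrite [p]p0; exists a, b, c; split=> //; exact: conic0.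
move=> [t t0 /IH[|a' [b' [c' [abc' con]]]]].
  by move=> r rL; apply: LF; rewrite inE rL orbT.
have [Fs sZ] := LF s (mem_head _ _).
exact: caratheodory_step abc' Fs sZ con t0.
Qed.

Definition unimodular a b c := forall m, lattice_points m -> dot w m = h ->
  exists x y z : R, [/\ x \is a Num.int, y \is a Num.int, z \is a Num.int &
    m = x *: a + y *: b + z *: c].

Lemma facet_coord_sum a b c m (x y z : R) : facet a -> facet b -> facet c ->
  dot w m = h -> m = x *: a + y *: b + z *: c -> x + y + z = 1.
Proof.
move=> [_ wa] [_ wb] [_ wc] wm mE; move: wm.
rewrite mE !dotDr !dotZr wa wb wc -!mulrDl => wm.
by apply: (mulIf (lt0r_neq0 h0)); rewrite wm mul1r.
Qed.

(* Reducing the coordinates of m modulo 1, and reflecting if their sum is 2, gives a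
   lattice point of the triangle. *)
Lemma nonunimodular_point a b c : lattice_triangle a b c -> ~ unimodular a b c ->
  exists m (x y z : R), [/\ facet m, lattice_points m, m = x *: a + y *: b + z *: c,
    [\/ 0 < x, 0 < y | 0 < z] & [/\ x < 1, y < 1 & z < 1]].
Proof.
move=> abc /existsNP[m /not_implyP[mZ /not_implyP[wm nint]]].
have [Fa Fb Fc] := lattice_triangle_facet abc.
have [aZ bZ cZ] := lattice_triangle_lattice abc.
have mE := cramer3 m (lt_det abc); move: mE.
set x := _ / _; set y := _ / _; set z := _ / _ => mE.
have sum1 := facet_coord_sum Fa Fb Fc wm mE.
have Fcomb (l k n : R) : 0 <= l -> 0 <= k -> 0 <= n -> l + k + n = 1 ->
    facet (l *: a + k *: b + n *: c).
  move: Fa Fb Fc => [Pa wa] [Pb wb] [Pc wc] l0 k0 n0 s1; split; first exact: cvx3.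
  by rewrite !dotDr !dotZr wa wb wc -!mulrDl s1 mul1r.
have frac (u : R) : exists k, [/\ k \is a Num.int, 0 <= u - k & u - k < 1].
  exists (Num.floor u)%:~R; split; first exact: intr_int.
    by have /andP[] := floor_itv u; lra.
  by have /andP[_] := floor_itv u; rewrite intrD; lra.
have [k1 [k1Z x0 x1]] := frac x; have [k2 [k2Z y0 y1]] := frac y.
have [k3 [k3Z z0 z1]] := frac z.
have m0Z : lattice_points ((x - k1) *: a + (y - k2) *: b + (z - k3) *: c).
  have -> : (x - k1) *: a + (y - k2) *: b + (z - k3) *: c =
      m - (k1 *: a + k2 *: b + k3 *: c).
    by rewrite [in RHS]mE; apply/rowP => i; rewrite !mxE; ring.
  by apply: latticeB => //; do 2! apply: latticeDZ => //; apply: latticeZ.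
have pos : 0 < x - k1 \/ 0 < y - k2 \/ 0 < z - k3.
  apply: contrapT => npos; apply: nint; exists x, y, z; split=> //.
  - suff -> : x = k1 by []. lra.
  - suff -> : y = k2 by []. lra.
  - suff -> : z = k3 by []. lra.
have kZ : 1 - (k1 + k2 + k3) \is a Num.int by rewrite rpredB ?rpred1 // !rpredD.
have kpos : 1 <= 1 - (k1 + k2 + k3) by apply: int_gt0 => //; case: pos => [|[]]; lra.
have [k1s|k2s] := lerP (1 - (k1 + k2 + k3)) 1.
  exists ((x - k1) *: a + (y - k2) *: b + (z - k3) *: c), (x - k1), (y - k2), (z - k3).
  split=> //; first by apply: Fcomb => //; lra.
  by case: pos => [|[]] ?; [apply: Or31|apply: Or32|apply: Or33].
have k2s' := int_ltD1 (rpred1 _) kZ k2s.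
have k3s : 1 - (k1 + k2 + k3) + 1 <= 3.
  by apply: int_ltD1 => //; lra.
exists ((1 - (x - k1)) *: a + (1 - (y - k2)) *: b + (1 - (z - k3)) *: c).
exists (1 - (x - k1)), (1 - (y - k2)), (1 - (z - k3)); split=> //.
- by apply: Fcomb; lra.
- have := latticeB (latticeD (latticeD aZ bZ) cZ) m0Z; congr lattice_points.
  by apply/rowP => i; rewrite !mxE; ring.
- by apply: Or31; lra.
- by split; lra.
Qed.

Lemma unimodular_triangle a b c p : lattice_triangle a b c -> conic [:: a; b; c] p ->
  exists a' b' c', [/\ lattice_triangle a' b' c', unimodular a' b' c' &
    conic [:: a'; b'; c'] p].
Proof.
have [N] : exists N : nat, `|det3 a b c| < N%:R.
  by exists (Num.bound `|det3 a b c|); exact: archi_boundP.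
elim: N a b c => [|N IH] a b c; first by rewrite ltNge normr_ge0.
move=> detN abc pabc; have [uni|nuni] := pselect (unimodular a b c).
  by exists a, b, c.
have [m [x [y [z [Fm mZ mE pos [x1 y1 z1]]]]]] := nonunimodular_point abc nuni.
have [t [b' [c' [k [t0 b'P c'P con [k0 kP detm]]]]]] := pivot mE pabc pos.
have k1 : k < 1 by move: kP; rewrite !inE => /or3P[]/eqP->.
have detpos : 0 < `|det3 a b c| by rewrite normr_gt0; exact: lt_det.
have mbc : lattice_triangle m b' c'.
  apply: (lattice_triangleS abc) => //.
  by rewrite detm; apply: mulf_neq0; [rewrite gt_eqF | exact: lt_det abc].
apply: (IH m b' c') => //; last by exists t.
have detZ a' b'' c'' : lattice_triangle a' b'' c'' -> `|det3 a' b'' c''| \is a Num.int.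
  move=> /lattice_triangle_lattice[aZ bZ cZ]; have := det3_int aZ bZ cZ.
  by case: ger0P => //; rewrite rpredN.
have lt : `|det3 m b' c'| < `|det3 a b c|.
  by rewrite detm normrM (gtr0_norm k0) -subr_gt0 -[X in X - _]mul1r -mulrBl mulr_gt0
    ?subr_gt0.
have := int_ltD1 (detZ _ _ _ mbc) (detZ _ _ _ abc) lt; move: detN; rewrite -natr1; lra.
Qed.

End FacetTriangles.

(** * Triangles without reflection in the polytope *)

Lemma seq_argmax (R : realType) (T : eqType) (f : T -> R) (L : seq T) s0 :
  s0 \in L -> exists2 t, t \in L & {in L, forall s, f s <= f t}.
Proof.
elim: L s0 => // r L IH s0 _; have [->|] := eqVneq L [::].
  by exists r; [rewrite mem_head | move=> s; rewrite inE => /eqP->].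
case: L IH => // q L IH _; have [t tL tmax] := IH q (mem_head _ _).
have [rt|tr] := lerP (f r) (f t).
  by exists t; [rewrite inE tL orbT | move=> s; rewrite inE => /predU1P[->|/tmax]].
exists r; first exact: mem_head.
by move=> s; rewrite inE => /predU1P[->//|/tmax st]; apply: le_trans st (ltW tr).
Qed.

Section StuckTriangles.
Variable R : realType.
Local Notation V := 'rV[R]_3.
Variables (P : set V) (S : seq V) (w : V) (h : R).
Hypothesis SZ : {in S, forall s, lattice_points s}.
Hypothesis PS : P = convex_hull [set` S].
Hypothesis Ssmooth : {in S, forall v, exists e u, smooth_vertex P v e u}.
Hypothesis wP : forall x, P x -> dot w x <= h.
Hypothesis h0 : 0 < h.
Implicit Types (a b c f g m t v : V).

Local Notation F := (facet P w h).

Let Pcvx : cvx P.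
Proof. by rewrite PS; exact: hull_cvx. Qed.

Let SP s : s \in S -> P s.
Proof. by rewrite PS; exact: hull_mem. Qed.

Lemma facet_max g p : F p -> exists2 s, s \in S & F s /\ dot g p <= dot g s.
Proof.
move=> [Pp wp]; apply: contrapT => none.
pose K := [set q | dot w q < h \/ dot w q = h /\ dot g q < dot g p].
have : K p.
  move: (Pp); rewrite [X in X p]PS;
    apply: (@hull_min _ _ _ K) => [q r t t0 t1 /= Kq Kr|s sS /=]; last first.
    have := wP (SP sS); rewrite le_eqVlt => /orP[/eqP ws|]; last by left.
    right; split=> //; rewrite ltNge; apply/negP => gs; apply: none.
    by exists s => //; split=> //; split=> //; exact: SP.
  rewrite /K /= !dotDr !dotZr.
  have [->|tn0] := eqVneq t 0; first by rewrite !mul0r !add0r subr0 !mul1r.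
  have [->|tn1] := eqVneq t 1; first by rewrite subrr !mul0r !addr0 !mul1r.
  have t0' : 0 < t by rewrite lt_neqAle eq_sym tn0.
  have t1' : t < 1 by rewrite lt_neqAle tn1.
  case: Kq Kr => [wq|[-> gq]] [wr|[-> gr]]; try by left; nra.
  by right; split; [ring | exact: convex_comb_lt].
by move=> [|[_]]; rewrite ?wp ltxx.
Qed.

Lemma facet_conic p : F p -> conic [seq s <- S | dot w s == h] p.
Proof.
move=> [Pp wp]; set L := [seq _ <- _ | _].
have [//|[g [gL gp]]] := farkas L p.
have [s sS [[Ps ws] gs]] := facet_max g (conj Pp wp).
have : dot g s <= 0 by apply: gL; rewrite mem_filter ws eqxx.
by move=> ?; have := lt_le_trans gp gs; rewrite ltNge => /negP[].
Qed.

Lemma facet_coeff v (e u : 'I_3 -> V) p : smooth_vertex P v e u -> dot w v = h ->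
  (forall i, 0 <= dot (u i) p) -> dot w p = 0 ->
  forall i, dot (u i) p * dot w (e i) = 0.
Proof.
move=> sv wv p0 wp i.
have : \sum_i - (dot (u i) p * dot w (e i)) = 0.
  rewrite sumrN -[X in - X](_ : dot w p = _) => [|]; first by rewrite wp oppr0.
  rewrite {1}(dual_expansion sv p) dot_sumr.
  by apply: eq_bigr => j _; rewrite dotZr.
move/eqP; rewrite psumr_eq0 => [|j _].
  by move=> /allP/(_ i (mem_index_enum _))/=; rewrite oppr_eq0 => /eqP.
rewrite oppr_ge0 mulr_ge0_le0 //.
by have := wP (sv_edge sv j); rewrite dotDr wv gerDl.
Qed.

(* If g drops by exactly 1 from t to m and by at least 1 to any other lattice point
   of the facet, then m - t, a nonnegative integral combination of the edge
   directions at t, is itself an edge direction, hence extreme in the cone at t. *)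
Lemma unit_drop_extreme g t m p q (r s : R) : t \in S -> F t ->
  (forall y, lattice_points y -> F y -> y != t -> dot g y <= dot g t - 1) ->
  F p -> F q -> 0 <= r -> 0 <= s -> lattice_points m ->
  m - t = r *: (p - t) + s *: (q - t) -> dot g (m - t) = -1 ->
  r *: (p - t) = (- dot g (r *: (p - t))) *: (m - t).
Proof.
move=> tS [Pt wt] gt [Pp wp'] [Pq wq] r0 s0 mZ mE gm.
have [e [u sv]] := Ssmooth tS; have tZ := SZ tS.
pose k i := dot (u i) (m - t); pose z i := dot (u i) (r *: (p - t)).
have z0 i : 0 <= z i by rewrite /z dotZr mulr_ge0 // (sv_cone sv).
have zk i : z i <= k i by rewrite /k mE dotDr lerDl dotZr mulr_ge0 // (sv_cone sv).
have k0 i : 0 <= k i by exact: le_trans (z0 i) (zk i).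
have kZ i : k i \is a Num.int.
  by apply: dot_int; [exact: dual_integral sv i | exact: latticeB].
have mtE : m - t = \sum_i k i *: e i := dual_expansion sv _.
have kwe i : k i * dot w (e i) = 0.
  apply: (facet_coeff sv wt k0).
  by rewrite mE dotDr !dotZr !dotBr wp' wq wt subrr !mulr0 addr0.
have ge i : k i * dot g (e i) <= - k i.
  have [->|ki] := eqVneq (k i) 0; first by rewrite mul0r oppr0.
  have wei : dot w (e i) = 0.
    by have /eqP := kwe i; rewrite mulf_eq0 (negbTE ki) => /eqP.
  have : dot g (t + e i) <= dot g t - 1.
    apply: gt; first by apply: latticeD => //; exact: dual_lattice sv i.
      by split; [exact: sv_edge sv i | rewrite dotDr wt wei addr0].
    rewrite -subr_eq0 addrC addKr; apply/eqP => ei0.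
    by have := dual_pairing sv i i; rewrite ei0 dot0r eqxx => /eqP;
      rewrite eq_sym oner_eq0.
  rewrite dotDr => hg; have := k0 i; nra.
have sumk : \sum_i k i <= 1.
  have : dot g (m - t) <= - \sum_i k i.
    rewrite mtE dot_sumr -sumrN; apply: ler_sum => i _; rewrite dotZr; exact: ge.
  by rewrite gm lerN2.
have [l kl] : exists l, k l != 0.
  apply: contrapT => none; move: gm; rewrite mtE big1 ?dot0r; first by lra.
  move=> i _; have [->|ki] := eqVneq (k i) 0; first by rewrite scale0r.
  by exfalso; apply: none; exists i.
have kl1 : 1 <= k l by apply: int_gt0 => //; rewrite lt_neqAle eq_sym kl k0.
have kj j : j != l -> k j = 0.
  move=> jl; apply/eqP; rewrite eq_le k0 andbT.
  move: sumk; rewrite (bigD1 l) //= (bigD1 j) //=.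
  have : 0 <= \sum_(i < 3 | (i != l) && (i != j)) k i by apply: sumr_ge0.
  lra.
have mtl : m - t = k l *: e l.
  by rewrite mtE (bigD1 l) //= big1 ?addr0 // => j /kj->; rewrite scale0r.
have kl1' : k l = 1.
  apply/eqP; rewrite eq_le kl1 andbT; move: sumk; rewrite (bigD1 l) //=.
  by rewrite big1 ?addr0 // => j /kj.
have zE : r *: (p - t) = z l *: (m - t).
  rewrite {1}(dual_expansion sv (r *: (p - t))) (bigD1 l) //= big1 ?addr0.
    by rewrite mtl kl1' scale1r.
  move=> j jl; suff -> : dot (u j) (r *: (p - t)) = 0 by rewrite scale0r.
  by apply/eqP; rewrite eq_le z0 andbT -(kj j jl) zk.
by rewrite {1}zE [in dot g _]zE dotZr gm mulrN1 opprK.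
Qed.

Lemma flip_mem a b c m (x y z : R) : P b -> P c -> P m ->
  m = x *: a + y *: b + z *: c -> x + y + z = 1 -> x < 0 -> 1 <= y -> 1 <= z ->
  P (b + c - a).
Proof.
move=> Pb Pc Pm mE s1 x0 y1 z1; have xn0 : x != 0 by rewrite lt_eqF.
have -> : b + c - a = (- x^-1) *: m + (1 + y / x) *: b + (1 + z / x) *: c.
  by rewrite mE; apply/rowP => i; rewrite !mxE; field.
have D (v : R) : v <= - x -> 0 <= 1 + v / x.
  move=> vx; have : v / x >= -1 by rewrite ler_ndivlMr // mulN1r.
  lra.
apply: cvx3 => //; first by rewrite oppr_ge0 invr_le0 ltW.
- by apply: D; lra.
- by apply: D; lra.
- have -> : z = 1 - x - y by lra.
  by field.
Qed.

Lemma ray_mem a b m (x : R) : P a -> P m -> m = x *: a + (1 - x) *: b -> 2 <= x ->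
  P (2 *: a - b).
Proof.
move=> Pa Pm mE x2; have xn1 : x - 1 != 0 by rewrite gt_eqF //; lra.
have := Pcvx (_ : 0 <= (x - 1)^-1) (_ : (x - 1)^-1 <= 1) Pm Pa.
have x1 : 0 <= (x - 1)^-1 by rewrite invr_ge0; lra.
have x1' : (x - 1)^-1 <= 1 by rewrite invf_le1; lra.
move=> /(_ x1 x1'); congr P; rewrite mE.
by apply/rowP => i; rewrite !mxE; field.
Qed.

Lemma two_cones_mem a b c m m' (x y z x' y' z' : R) : P a -> P b -> P m -> P m' ->
  m = x *: a + y *: b + z *: c -> x + y + z = 1 -> y <= 0 -> z <= -1 ->
  m' = x' *: a + y' *: b + z' *: c -> x' + y' + z' = 1 -> x' <= 0 -> z' <= -1 ->
  P (a + b - c).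
Proof.
move=> Pa Pb Pm Pm' mE s1 y0 z1 mE' s1' x0 z1'.
have inv01 (v : R) : v <= -1 -> 0 <= - v^-1 /\ - v^-1 <= 1.
  move=> v1; rewrite -invrN invr_ge0 invf_le1; last by lra.
  by split; lra.
have [zi0 zi1] := inv01 z z1; have [zi0' zi1'] := inv01 z' z1'.
have zn0 : z != 0 by rewrite lt_eqF //; lra.
have zn0' : z' != 0 by rewrite lt_eqF //; lra.
have PX := Pcvx zi0 zi1 Pm Pa; have PY := Pcvx zi0' zi1' Pm' Pb.
pose p := - (y / z); pose q := - (x' / z').
have p0 : p <= 0 by rewrite /p oppr_le0 mulr_le0 // invr_le0; lra.
have q0 : q <= 0 by rewrite /q oppr_le0 mulr_le0 // invr_le0; lra.
have pq0 : 2 - p - q != 0 by rewrite gt_eqF //; lra.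
have t0 : 0 <= (1 - q) / (2 - p - q) by apply: divr_ge0; lra.
have t1 : (1 - q) / (2 - p - q) <= 1 by rewrite ler_pdivrMr; lra.
have := Pcvx t0 t1 PX PY; congr P; rewrite mE mE'.
have yE : y = - (p * z) by rewrite /p mulNr divfK // opprK.
have xE : x' = - (q * z') by rewrite /q mulNr divfK // opprK.
have -> : x = 1 - y - z by lra.
have -> : y' = 1 - x' - z' by lra.
move: (p) (q) yE xE pq0 => p' q' -> -> pq0.
by apply/rowP => i; rewrite !mxE; field; rewrite pq0 zn0 zn0'.
Qed.

Record stuck a b c : Prop := Stuck {
  st_triangle : lattice_triangle P w h a b c;
  st_unimodular : unimodular w h a b c;
  st_flipa : ~ P (b + c - a);
  st_flipb : ~ P (c + a - b);
  st_flipc : ~ P (a + b - c) }.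

Lemma stuck_rot a b c : stuck a b c -> stuck b c a.
Proof.
move=> [[T D] U fa fb fc]; split=> //; first split.
- by move=> x xbca; apply: T; rewrite !inE in xbca *; rewrite orbC -orbA.
- by rewrite det3_rot.
- move=> m mZ wm; have [x [y [z [xZ yZ zZ ->]]]] := U m mZ wm.
  by exists y, z, x; split=> //; rewrite -addrA addrC.
Qed.

Lemma det3_swap a b c : det3 b a c = - det3 a b c.
Proof. by rewrite !det3E; ring. Qed.

Lemma stuck_swap a b c : stuck a b c -> stuck b a c.
Proof.
move=> [[T D] U fa fb fc]; split; first split.
- by move=> x xbca; apply: T; rewrite !inE in xbca *; rewrite orbCA.
- by rewrite det3_swap oppr_eq0.
- move=> m mZ wm; have [x [y [z [xZ yZ zZ ->]]]] := U m mZ wm.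
  by exists y, x, z; split=> //; rewrite [X in X + _]addrC.
- by rewrite [a + c]addrC.
- by rewrite [c + b]addrC.
- by rewrite [b + a]addrC.
Qed.

Lemma lattice_triangle_neq a b c : lattice_triangle P w h a b c -> a != b.
Proof.
by move=> [_]; apply: contraNneq => ->; rewrite det3E; apply/eqP; ring.
Qed.

Lemma triangle_coord a b c : det3 a b c != 0 ->
  exists g, forall x y z : R, dot g (x *: a + y *: b + z *: c) = z.
Proof.
move=> D; exists ((det3 a b c)^-1 *: cross a b) => x y z.
rewrite dotZl dotC -/(det3 _ a b).
have -> : x *: a + y *: b + z *: c = z *: c + x *: a + y *: b by rewrite addrC addrA.
by rewrite det3_combl (det3_rot b c a) (det3_rot a b c) mulrCA mulVf ?mulr1.
Qed.

(* Otherwise the lattice points of the facet on the side of c of the line ab all lie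
   on the ray from a to c.  The last one, t, is a vertex, and the step a - c from t
   lies strictly between the directions of 2a - b and b. *)
Lemma stuck_no_ray a b c : stuck a b c -> ~ P (2 *: a - b).
Proof.
move=> st Pa'; have [T U fa fb fc] := st.
have [Fa Fb Fc] := lattice_triangle_facet T;
  have [aZ bZ cZ] := lattice_triangle_lattice T.
have [[[Pa wa] [Pb wb]] [Pc wc]] := (Fa, Fb, Fc).
have [g gE] := triangle_coord (lt_det T).
have ga : dot g a = 0 by rewrite -(gE 1 0 0) scale1r !scale0r !addr0.
have gb : dot g b = 0 by rewrite -(gE 0 1 0) scale1r !scale0r addr0 add0r.
have gc : dot g c = 1 by rewrite -(gE 0 0 1) scale1r !scale0r !add0r.
have Fa' : F (2 *: a - b) by split=> //; rewrite dotBr dotZr wa wb; ring.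
have column m : lattice_points m -> F m -> 1 <= dot g m ->
    m = (1 - dot g m) *: a + dot g m *: c.
  move=> mZ [Pm wm]; have [x [y [z [xZ yZ zZ mE]]]] := U m mZ wm.
  have s1 := facet_coord_sum h0 Fa Fb Fc wm mE.
  rewrite {1 3 4}mE gE => z1.
  have x0 : x <= 0.
    rewrite leNgt; apply/negP => /(int_gt0 xZ) x1; apply: fb.
    by apply: (@flip_mem b c a m y z x) => //; [rewrite mE -addrA addrC | lra | lra].
  have y0 : y <= 0.
    rewrite leNgt; apply/negP => /(int_gt0 yZ) y1; apply: fa.
    by apply: (@flip_mem a b c m x y z) => //; lra.
  have y00 : y = 0.
    apply/eqP; rewrite eq_le y0 leNgt /=; apply/negP => /(int_lt0 yZ) y1; apply: fb.
    have := @flip_mem a (2 *: a - b) c m (x + 2 * y) (- y) z.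
    rewrite (_ : 2 *: a - b + c - a = c + a - b); last first.
      by apply/rowP => i; rewrite !mxE; ring.
    by apply=> //; [rewrite mE; apply/rowP => i; rewrite !mxE; ring|lra|lra|lra].
  by rewrite mE y00 scale0r addr0; congr (_ *: _ + _); lra.
have [s0 s0S [[Ps0 ws0]]] := facet_max g Fc; rewrite gc => gs0.
have [t] : exists2 t, t \in [seq s <- S | dot w s == h] &
    {in [seq s <- S | dot w s == h], forall s, dot g s <= dot g t}.
  by apply: (@seq_argmax _ _ _ _ s0); rewrite mem_filter ws0 eqxx.
rewrite mem_filter => /andP[/eqP wt tS] tmax.
have Ft : F t by split=> //; exact: SP.
have topF p : F p -> dot g p <= dot g t.
  move=> Fp; have [s sS [[_ ws] gs]] := facet_max g Fp.
  by apply: le_trans gs _; apply: tmax; rewrite mem_filter ws eqxx.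
have gt1 : 1 <= dot g t by have := topF c Fc; rewrite gc.
have tE := column t (SZ tS) Ft gt1.
have gZ p : lattice_points p -> F p -> dot g p \is a Num.int.
  move=> pZ [_ wp']; have [x [y [z [_ _ zZ ->]]]] := U p pZ wp'.
  by rewrite gE.
have drop p : lattice_points p -> F p -> p != t -> dot g p <= dot g t - 1.
  move=> pZ Fp pt; suff : dot g p < dot g t.
    by move=> /(int_ltD1 (gZ p pZ Fp) (gZ t (SZ tS) Ft)); lra.
  rewrite lt_neqAle topF // andbT; apply: contraNneq pt => gpt.
  by rewrite (column p pZ Fp) gpt // -tE.
have [j gtj] : exists j, dot g t = j by exists (dot g t).
rewrite gtj in gt1 tE.
have jn0 : j != 0 by rewrite gt_eqF //; lra.
have r0 : 0 <= (2 * j)^-1 by rewrite invr_ge0; lra.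
have mZ : lattice_points (t + a - c) by apply: latticeB => //; apply: latticeD => //;
  exact: SZ.
have mE : t + a - c - t = (2 * j)^-1 *: (2 *: a - b - t) + (2 * j)^-1 *: (b - t).
  by rewrite tE; apply/rowP => i; rewrite !mxE; field.
have gm : dot g (t + a - c - t) = -1 by rewrite !dotr ga gc gtj; ring.
have := unit_drop_extreme tS Ft drop Fa' Fb r0 r0 mZ mE gm.
rewrite dotZr !dotBr dotZr ga gb gtj => E.
have : (2 * j) *: ((2 * j)^-1 *: (2 *: a - b - t)) = j *: (a - c).
  rewrite E; apply/rowP => i; rewrite !mxE; field; exact: jn0.
rewrite scalerA divff ?mulf_neq0 // scale1r tE => E'.
have /eqP[] := lattice_triangle_neq T.
apply/rowP => i; have /rowP/(_ i) := E'; rewrite !mxE; lra.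
Qed.

(* Otherwise b is the only lattice point of the facet with positive b-coordinate, and
   a - b lies strictly between c - b and m - b. *)
Lemma stuck_no_cone a b c m (x y z : R) : stuck a b c -> P m ->
  m = x *: a + y *: b + z *: c -> x + y + z = 1 -> y <= -1 -> z <= -1 -> False.
Proof.
move=> st Pm mE s1 y1 z1; have [T U fa fb fc] := st.
have [Fa Fb Fc] := lattice_triangle_facet T;
  have [aZ bZ cZ] := lattice_triangle_lattice T.
have [[[Pa wa] [Pb wb]] [Pc wc]] := (Fa, Fb, Fc).
have [g gE'] := triangle_coord (lt_det (st_triangle (stuck_rot (stuck_rot st)))).
have gE x' y' z' : dot g (x' *: a + y' *: b + z' *: c) = y'.
  by rewrite -[RHS](gE' z' x' y'); congr dot; rewrite addrC addrA.
have ga : dot g a = 0 by rewrite -(gE 1 0 0) scale1r !scale0r !addr0.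
have gb : dot g b = 1 by rewrite -(gE 0 1 0) scale1r !scale0r addr0 add0r.
have gc : dot g c = 0 by rewrite -(gE 0 0 1) scale1r !scale0r !add0r.
have low p : lattice_points p -> F p -> p != b -> dot g p <= dot g b - 1.
  move=> pZ [Pp wp']; have [x' [y' [z' [xZ yZ zZ pE]]]] := U p pZ wp'.
  have s1' := facet_coord_sum h0 Fa Fb Fc wp' pE.
  rewrite gb subrr {2}pE gE leNgt => pb; apply/negP => /(int_gt0 yZ) y1'.
  have x0 : x' <= 0.
    rewrite leNgt; apply/negP => /(int_gt0 xZ) x1; apply: fc.
    by apply: (@flip_mem c a b p z' x' y') => //; [rewrite pE addrC addrA | lra | lra].
  have z0 : z' <= 0.
    rewrite leNgt; apply/negP => /(int_gt0 zZ) z1'; apply: fa.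
    by apply: (@flip_mem a b c p x' y' z') => //; lra.
  have [x00|xn0] := eqVneq x' 0.
    have [z00|zn0] := eqVneq z' 0.
      by case/eqP: pb; rewrite pE x00 z00 !scale0r addr0 add0r (_ : y' = 1) ?scale1r
        //; lra.
    have z1' : z' <= -1 by apply: int_lt0 => //; rewrite lt_neqAle zn0.
    apply: (stuck_no_ray (stuck_rot st)); apply: (@ray_mem b c p y') => //; last by lra.
    by rewrite pE x00 scale0r add0r; congr (_ + _ *: _); lra.
  have x1 : x' <= -1 by apply: int_lt0 => //; rewrite lt_neqAle xn0.
  have [z00|zn0] := eqVneq z' 0.
    apply: (stuck_no_ray (stuck_swap st)); apply: (@ray_mem b a p y') => //;
      last by lra.
    by rewrite pE z00 scale0r addr0 addrC; congr (_ + _ *: _); lra.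
  have z1' : z' <= -1 by apply: int_lt0 => //; rewrite lt_neqAle zn0.
  by apply: fc; apply: (two_cones_mem Pa Pb Pm Pp mE s1 _ z1 pE s1' _ z1'); lra.
have bS : b \in S.
  have [s sS [Fs]] := facet_max g Fb; rewrite gb => gs.
  have [<-//|sb] := eqVneq s b.
  by have := low s (SZ sS) Fs sb; rewrite gb; lra.
have xn0 : x != 0 by rewrite gt_eqF //; lra.
have r0 : 0 <= - (z / x) by rewrite -mulNr; apply: divr_ge0; lra.
have x0 : 0 <= x^-1 by rewrite invr_ge0; lra.
have Fm : F m.
  by split=> //; rewrite mE !dotDr !dotZr wa wb wc -!mulrDl s1 mul1r.
have mE' : a - b = - (z / x) *: (c - b) + x^-1 *: (m - b).
  rewrite mE; have -> : y = 1 - x - z by lra.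
  by apply/rowP => i; rewrite !mxE; field.
have gab : dot g (a - b) = -1 by rewrite dotBr ga gb; ring.
have := unit_drop_extreme bS Fb low Fc Fm r0 x0 aZ mE' gab.
rewrite dotZr dotBr gc gb sub0r mulrN1 opprK => E.
have zn0 : z / x != 0 by rewrite mulf_neq0 ?invr_eq0 // lt_eqF //; lra.
have /eqP[] := lattice_triangle_neq (st_triangle (stuck_rot (stuck_rot st))).
have : - (z / x) *: (c - b) = - (z / x) *: (a - b) by [].
by move=> /(scalerI _)-/(_ _)/addIr; apply; rewrite oppr_eq0.
Qed.

Lemma stuck_lattice a b c m : stuck a b c -> F m -> lattice_points m ->
  m \in [:: a; b; c].
Proof.
have main a' b' c' (x y z : R) : stuck a' b' c' -> F m ->
    y \is a Num.int -> z \is a Num.int -> m = x *: a' + y *: b' + z *: c' ->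
    1 <= x -> m = a'.
  move=> st [Pm wm] yZ zZ mE x1; have [T U fa fb fc] := st.
  have [Fa Fb Fc] := lattice_triangle_facet T.
  have [[[Pa wa] [Pb wb]] [Pc wc]] := (Fa, Fb, Fc).
  have s1 := facet_coord_sum h0 Fa Fb Fc wm mE.
  have y0 : y <= 0.
    rewrite leNgt; apply/negP => /(int_gt0 yZ) y1; apply: fc.
    by apply: (@flip_mem c' a' b' m z x y) => //; [rewrite mE addrC addrA | lra | lra].
  have z0 : z <= 0.
    rewrite leNgt; apply/negP => /(int_gt0 zZ) z1; apply: fb.
    by apply: (@flip_mem b' c' a' m y z x) => //; [rewrite mE -addrA addrC | lra | lra].
  have [y00|yn0] := eqVneq y 0; have [z00|zn0] := eqVneq z 0.
  - by rewrite mE y00 z00 !scale0r !addr0 (_ : x = 1) ?scale1r //; lra.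
  - exfalso; have z1 : z <= -1 by apply: int_lt0 => //; rewrite lt_neqAle zn0.
    apply: (stuck_no_ray (stuck_swap (stuck_rot (stuck_rot st)))).
    apply: (@ray_mem a' c' m x) => //; last by lra.
    by rewrite mE y00 scale0r addr0; congr (_ + _ *: _); lra.
  - exfalso; have y1 : y <= -1 by apply: int_lt0 => //; rewrite lt_neqAle yn0.
    apply: (stuck_no_ray st); apply: (@ray_mem a' b' m x) => //; last by lra.
    by rewrite mE z00 scale0r addr0; congr (_ + _ *: _); lra.
  - exfalso; have z1 : z <= -1 by apply: int_lt0 => //; rewrite lt_neqAle zn0.
    have y1 : y <= -1 by apply: int_lt0 => //; rewrite lt_neqAle yn0.
    exact: stuck_no_cone st Pm mE s1 y1 z1.
move=> st Fm mZ; have [x [y [z [xZ yZ zZ mE]]]] := st_unimodular st mZ (proj2 Fm).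
have [Fa Fb Fc] := lattice_triangle_facet (st_triangle st).
have s1 := facet_coord_sum h0 Fa Fb Fc (proj2 Fm) mE.
have [/(int_gt0 xZ) x1|x0] := ltrP 0 x.
  by rewrite (main a b c x y z st Fm yZ zZ mE x1) !inE eqxx.
have [/(int_gt0 yZ) y1|y0] := ltrP 0 y.
  by rewrite (main b c a y z x (stuck_rot st) Fm zZ xZ _ y1) ?inE ?eqxx ?orbT //
    mE -addrA addrC.
have z1 : 1 <= z by lra.
by rewrite (main c a b z x y (stuck_rot (stuck_rot st)) Fm xZ yZ _ z1) ?inE ?eqxx
  ?orbT // mE addrC addrA.
Qed.

Lemma stuck_vertex a b c : stuck a b c -> a \in S.
Proof.
move=> st; have stb := stuck_rot st.
have [Fa Fb Fc] := lattice_triangle_facet (st_triangle st).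
have [g gE] := triangle_coord (lt_det (st_triangle stb)).
have ga : dot g a = 1 by rewrite -(gE 0 0 1) scale1r !scale0r !add0r.
have gb : dot g b = 0 by rewrite -(gE 1 0 0) scale1r !scale0r !addr0.
have gc : dot g c = 0 by rewrite -(gE 0 1 0) scale1r !scale0r addr0 add0r.
have [s sS [Fs]] := facet_max g Fa; rewrite ga => gs.
have := stuck_lattice st Fs (SZ sS); rewrite !inE => /or3P[/eqP<-//|/eqP sE|/eqP sE].
  by move: gs; rewrite sE gb; lra.
by move: gs; rewrite sE gc; lra.
Qed.

End StuckTriangles.

Lemma sum_ord3 (V : zmodType) (F : 'I_3 -> V) (i j k : 'I_3) :
  i != j -> k != i -> k != j -> \sum_l F l = F i + F j + F k.
Proof.
move=> ij ki kj; rewrite (bigD1 i) //= (bigD1 j) /=; last by rewrite eq_sym.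
rewrite (bigD1 k) /=; last by rewrite ki kj.
rewrite big_pred0 ?addr0 ?addrA // => l; apply/negP => /andP[/andP[li lj] lk].
have U : uniq [:: l; k; j; i].
  by rewrite /= !inE !negb_or li lj lk ki kj /= eq_sym ij.
by have := max_card (mem [:: l; k; j; i]); rewrite (card_uniqP U) card_ord.
Qed.

Lemma third_index (i j : 'I_3) : exists k, k != i /\ k != j.
Proof.
have : (0 < #|[set~ i] :\ j|)%N.
  have := cardsD1 j [set~ i]; rewrite cardsC1 card_ord /=.
  by case: (_ \in _) => /=; lia.
by case/card_gt0P => k; rewrite !inE => /andP[kj ki]; exists k.
Qed.

Section StuckDecomposition.
Variable R : realType.
Local Notation V := 'rV[R]_3.
Variables (P : set V) (S : seq V) (w : V) (h : R) (e0 : V).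
Hypothesis SZ : {in S, forall s, lattice_points s}.
Hypothesis PS : P = convex_hull [set` S].
Hypothesis Ssmooth : {in S, forall v, exists e u, smooth_vertex P v e u}.
Hypothesis Psym : forall x, P x -> P (- x).
Hypothesis wP : forall x, P x -> dot w x <= h.
Hypothesis h0 : 0 < h.
Hypothesis wZ : lattice_points w.
Hypothesis e0Z : lattice_points e0.
Hypothesis we0 : dot w e0 = -1.
Implicit Types (a b c e f g p v x : V).

Local Notation F := (facet P w h).
Local Notation stuck := (stuck P w h).

Let Pcvx : cvx P.
Proof. by rewrite PS; exact: hull_cvx. Qed.

Lemma stuck_edge a b c (e u : 'I_3 -> V) : stuck a b c -> smooth_vertex P a e u ->
  (forall i, dot w (e i) = 0 -> e i = b - a \/ e i = c - a) /\
  exists i, e i = b - a.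
Proof.
move=> st sv; have T := st_triangle st.
have [Fa Fb Fc] := lattice_triangle_facet T;
  have [aZ bZ cZ] := lattice_triangle_lattice T.
have [[[Pa wa] [Pb wb]] [Pc wc]] := (Fa, Fb, Fc).
have edge i : dot w (e i) = 0 -> e i = b - a \/ e i = c - a.
  move=> wei; have := @stuck_lattice _ _ _ _ _ SZ PS Ssmooth wP h0 a b c (a + e i) st.
  have Fe : F (a + e i) by split; [exact: sv_edge sv i | rewrite dotDr wa wei addr0].
  have eZ : lattice_points (a + e i) by apply: latticeD => //; exact: dual_lattice sv i.
  move=> /(_ Fe eZ); rewrite !inE -subr_eq0 addrC addKr => /or3P[/eqP
    ei0|/eqP<-|/eqP<-].
  - by have := dual_pairing sv i i; rewrite ei0 dot0r eqxx => /eqP;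
    rewrite eq_sym oner_eq0.
  - by left; rewrite addrAC subrr add0r.
  - by right; rewrite addrAC subrr add0r.
split=> //; apply: contrapT => none.
have [g gE] := triangle_coord (lt_det (st_triangle (stuck_rot (stuck_rot st)))).
have ga : dot g a = 0 by rewrite -(gE 0 1 0) scale1r !scale0r addr0 add0r.
have gb : dot g b = 1 by rewrite -(gE 0 0 1) scale1r !scale0r !add0r.
have gc : dot g c = 0 by rewrite -(gE 1 0 0) scale1r !scale0r !addr0.
pose k i := dot (u i) (b - a).
have k0 i : 0 <= k i by exact: sv_cone sv i _ Pb.
have baE : b - a = \sum_i k i *: e i := dual_expansion sv _.
have kwe i : k i * dot w (e i) = 0.
  by apply: (facet_coeff wP sv wa k0); rewrite dotBr wa wb subrr.
have : dot g (b - a) = 0.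
  rewrite baE dot_sumr big1 // => i _; rewrite dotZr; apply/eqP; rewrite mulf_eq0.
  have [//|ki] := eqVneq (k i) 0; have /eqP := kwe i.
  rewrite mulf_eq0 (negbTE ki) => /eqP/edge[ei|->]; first by exfalso; apply: none;
    exists i.
  by rewrite dotBr ga gc subrr eqxx.
by rewrite dotBr ga gb => /eqP; rewrite subr0 oner_eq0.
Qed.

Record facet_basis a b c e f g : Prop := FacetBasis {
  fb_edge : P (a + e);
  fb_edge_lattice : lattice_points e;
  fb_latticel : lattice_points f;
  fb_latticer : lattice_points g;
  fb_w : dot w e = -1;
  fb_pairl : [/\ dot f (b - a) = 1, dot f (c - a) = 0 & dot f e = 0];
  fb_pairr : [/\ dot g (b - a) = 0, dot g (c - a) = 1 & dot g e = 0];
  fb_expansion : forall x,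
    x = dot f x *: (b - a) + dot g x *: (c - a) - dot w x *: e;
  fb_cone : forall x, P x -> 0 <= dot f (x - a) /\ 0 <= dot g (x - a) }.

Lemma stuck_basis a b c : stuck a b c -> exists e f g, facet_basis a b c e f g.
Proof.
move=> st; have [[Pa wa] _ _] := lattice_triangle_facet (st_triangle st).
have aS := stuck_vertex SZ PS Ssmooth wP h0 st.
have [e [u sv]] := Ssmooth aS.
have [edge [i ei]] := stuck_edge st sv.
have [_ [j ej]] := stuck_edge (stuck_swap (stuck_rot (stuck_rot st))) sv.
have ij : i != j.
  apply/eqP => ij; have /eqP[] := lattice_triangle_neq (st_triangle (stuck_rot st)).
  by apply: (addIr (- a)); rewrite -ei ij.
have [k [ki kj]] := third_index i j.
have pair := dual_pairing sv.
have xE x : x = dot (u i) x *: (b - a) + dot (u j) x *: (c - a) + dot (u k) x *: e k.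
  by rewrite -ei -ej {1}(dual_expansion sv x) (sum_ord3 _ ij ki kj).
have wei : dot w (b - a) = 0.
  have [[_ wa'] [_ wb] _] := lattice_triangle_facet (st_triangle st).
  by rewrite dotBr wa' wb subrr.
have wej : dot w (c - a) = 0.
  have [[_ wa'] _ [_ wc]] := lattice_triangle_facet (st_triangle st).
  by rewrite dotBr wa' wc subrr.
have wE x : dot w x = dot (u k) x * dot w (e k).
  by rewrite {1}[x]xE !dotDr !dotZr wei wej !mulr0 !add0r.
have wek : dot w (e k) = -1.
  have wek0 : dot w (e k) <= 0 by have := wP (sv_edge sv k); rewrite dotDr wa gerDl.
  have wekZ : dot w (e k) \is a Num.int by apply: dot_int => //;
    exact: dual_lattice sv k.
  have ukZ : dot (u k) e0 \is a Num.int by apply: dot_int => //;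
    exact: dual_integral sv k.
  have := wE e0; rewrite we0 => E.
  have wlt : dot w (e k) < 0.
    by rewrite lt_neqAle wek0 andbT; apply/eqP => w0; move: E; rewrite w0; lra.
  have wle := int_lt0 wekZ wlt.
  have ugt : 0 < dot (u k) e0 by nra.
  have := int_gt0 ukZ ugt; nra.
exists (e k), (u i), (u j); split.
- exact: sv_edge sv k.
- exact: dual_lattice sv k.
- exact: dual_integral sv i.
- exact: dual_integral sv j.
- exact: wek.
- by rewrite -ei -ej !pair eqxx (negbTE ij) eq_sym (negbTE ki).
- by rewrite -ei -ej !pair eqxx eq_sym (negbTE ij) eq_sym (negbTE kj).
- by move=> x; rewrite wE wek mulrN1 scaleNr opprK; exact: xE.
- by move=> x Px; split; exact: sv_cone sv _ _ Px.
Qed.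

Lemma stuck_wedge a b c : stuck a b c -> exists e f g (k : R),
  [/\ facet_basis a b c e f g, k \is a Num.int, P (b + e + k *: (b - a)),
      P (c + e + k *: (c - a)) &
      forall x, P x -> dot f (x - a) + dot g (x - a) <= 1 + k * (h - dot w x)].
Proof.
move=> st; have [[Pa wa] [Pb wb] [Pc wc]] := lattice_triangle_facet (st_triangle st).
have [e [f [g B]]] := stuck_basis st.
have [e1 [f1 [g1 B1]]] := stuck_basis (stuck_swap st).
have [e2 [f2 [g2 B2]]] := stuck_basis (stuck_rot (stuck_rot st)).
have [[fb fc fe] [gb gc ge]] := (fb_pairl B, fb_pairr B).
have [[f1a f1c f1e] [g1a g1c g1e]] := (fb_pairl B1, fb_pairr B1).
have [[f2a f2b f2e] [g2a g2b g2e]] := (fb_pairl B2, fb_pairr B2).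
pose k := dot f e1; pose k' := dot g e2.
have e1E' : e1 = k *: (b - a) + dot g e1 *: (c - a) + e.
  by rewrite {1}(fb_expansion B e1) (fb_w B1) scaleN1r opprK.
have e2E' : e2 = dot f e2 *: (b - a) + k' *: (c - a) + e.
  by rewrite {1}(fb_expansion B e2) (fb_w B2) scaleN1r opprK.
rewrite !dotBr in fb fc gb gc f1a f1c g1a g1c f2a f2b g2a g2b.
have g1E : (dot g1 b - dot g1 a = 0) * (dot g1 c - dot g1 a = 1) by split; lra.
have f1E : (dot f1 b - dot f1 a = -1) * (dot f1 c - dot f1 a = -1) by split; lra.
have g2E : (dot g2 b - dot g2 a = 1) * (dot g2 c - dot g2 a = 0) by split; lra.
have f2E : (dot f2 b - dot f2 a = -1) * (dot f2 c - dot f2 a = -1) by split; lra.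
have ge1 : dot g e1 = 0.
  apply/eqP; rewrite eq_le; apply/andP; split.
    have [_] := fb_cone B1 (fb_edge B); move: g1e; rewrite {1}e1E' !dotr !g1E; lra.
  have [_] := fb_cone B (fb_edge B1); rewrite !dotr; lra.
have fe2 : dot f e2 = 0.
  apply/eqP; rewrite eq_le; apply/andP; split.
    have [_] := fb_cone B2 (fb_edge B); move: g2e; rewrite {1}e2E' !dotr !g2E; lra.
  have [] := fb_cone B (fb_edge B2); rewrite !dotr; lra.
have e1E : e1 = k *: (b - a) + e by rewrite e1E' ge1 scale0r addr0.
have e2E : e2 = k' *: (c - a) + e by rewrite e2E' fe2 scale0r add0r.
have kk' : k' = k.
  apply/eqP; rewrite eq_le; apply/andP; split.
    have [] := fb_cone B1 (fb_edge B2); move: f1e; rewrite e2E e1E !dotr !f1E; lra.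
  have [] := fb_cone B2 (fb_edge B1); move: f2e; rewrite e2E e1E !dotr !f2E; lra.
exists e, f, g, k; split=> //.
- by apply: dot_int; [exact: fb_latticel B | exact: fb_edge_lattice B1].
- by have := fb_edge B1; rewrite e1E addrA addrAC.
- by have := fb_edge B2; rewrite e2E kk' addrA addrAC.
move=> x Px; have [+ _] := fb_cone B1 Px.
have f1e0 : dot f1 e = k by move: f1e; rewrite e1E !dotr !f1E; lra.
have xE : x - b = (x - a) + (a - b) by rewrite addrA subrK.
rewrite xE dotDr {1}(fb_expansion B (x - a)) !dotr f1e0 !f1E wa; lra.
Qed.

Lemma stuck_decomposes a b c n p : stuck a b c -> conic [:: a; b; c] p ->
  lattice_points p -> dilate n P p -> (0 < n)%N -> decomposes P n p.
Proof.
move=> st /conic3P[l [m [r [l0 m0 r0 pE]]]] pZ [y Py yp] n0.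
have [[Pa wa] [Pb wb] [Pc wc]] := lattice_triangle_facet (st_triangle st).
have [aZ bZ cZ] := lattice_triangle_lattice (st_triangle st).
have [e [f [g [k [B kZ Pbe Pce cone]]]]] := stuck_wedge st.
have P0 := cvx_sym0 Pcvx Psym Pa.
have n0' : 0 < n%:R :> R by rewrite ltr0n.
have [[fb fc fe] [gb gc ge]] := (fb_pairl B, fb_pairr B).
rewrite !dotBr in fb fc gb gc.
have fa : 1 <= - dot f a.
  have fZ : - dot f a \is a Num.int by rewrite rpredN; apply: dot_int => //;
    exact: fb_latticel B.
  apply: int_gt0 => //; have [+ _] := fb_cone B P0.
  have [+ _] := fb_cone B (Psym Pb).
  by rewrite !dotr; lra.
have ga : 1 <= - dot g a.
  have gZ : - dot g a \is a Num.int by rewrite rpredN; apply: dot_int => //;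
    exact: fb_latticer B.
  apply: int_gt0 => //; have [_ +] := fb_cone B P0.
  have [_ +] := fb_cone B (Psym Pc).
  by rewrite !dotr; lra.
have k1 : 1 <= k.
  apply: int_gt0 => //; rewrite -(pmulr_lgt0 _ h0).
  by have := cone _ P0; rewrite !dotr; lra.
have k1Z : k + 1 \is a Num.int by rewrite rpredD ?rpred1.
have eZ := fb_edge_lattice B.
have Pe1 : P (a + e + (k + 1) *: (b - a)).
  by move: Pbe; congr P; apply/rowP => i; rewrite !mxE; ring.
have Pe2 : P (a + e + (k + 1) *: (c - a)).
  by move: Pce; congr P; apply/rowP => i; rewrite !mxE; ring.
pose z := n%:R * h - dot w p.
have aE : h \is a Num.int by rewrite -wa dot_int.
have zZ : z \is a Num.int by rewrite rpredB ?rpredM ?rpred_nat ?dot_int.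
have z0 : 0 <= z by rewrite /z -yp dotZr subr_ge0 ler_pM2l // wP.
have [f0 g0] := fb_cone B Py.
have [zn|zn] := lerP z n%:R.
  have pE' : p = n%:R *: a + dot f (p - n%:R *: a) *: (b - a) +
      dot g (p - n%:R *: a) *: (c - a) + z *: e.
    rewrite -{1}(subrK (n%:R *: a) p) {1}(fb_expansion B (p - n%:R *: a)).
    by rewrite /z !dotr wa; apply/rowP => i; rewrite !mxE; ring.
  rewrite pE'; apply: (@wedge_decomposes _ _ _ Pcvx _ _ _ _ _ (k + 1)) => //.
  - lra.
  - by rewrite addrC subrK.
  - by rewrite addrC subrK.
  - exact: fb_edge B.
  - exact: latticeB.
  - exact: latticeB.
  - by apply: dot_int; [exact: fb_latticel B | apply: latticeB => //;
    apply: latticeZ => //; exact: rpred_nat].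
  - by apply: dot_int; [exact: fb_latticer B | apply: latticeB => //;
    apply: latticeZ => //; exact: rpred_nat].
  - by rewrite -yp -scalerBr dotZr mulr_ge0 // ltW.
  - by rewrite -yp -scalerBr dotZr mulr_ge0 // ltW.
  - by rewrite z0 zn.
  - by have := cone _ Py; rewrite /z -yp -!scalerBr !dotZr; nra.
have wp : dot w p = (l + m + r) * h.
  by rewrite pE !dotDr !dotZr wa wb wc -!mulrDl.
have h1 : 1 < h.
  have : 0 <= dot w p by rewrite wp mulr_ge0 ?addr_ge0 // ltW.
  by move: zn; rewrite /z; nra.
have [q [Pq wq pq]] : exists q, [/\ P q, dot w q = h & p = (l + m + r) *: q].
  have [s0|s0] := eqVneq (l + m + r) 0.
    exists a; split=> //; rewrite s0 scale0r pE.
    have [-> -> ->] : [/\ l = 0, m = 0 & r = 0] by split; lra.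
    by rewrite !scale0r !addr0.
  have spos : 0 < l + m + r by rewrite lt_neqAle eq_sym s0 !addr_ge0.
  exists ((l + m + r)^-1 *: p); split; last by rewrite scalerA divff // scale1r.
    rewrite pE !scalerDr !scalerA; apply: cvx3;
      rewrite ?mulr_ge0 ?invr_ge0 ?(ltW spos) //.
    by rewrite -!mulrDr mulVf.
  by rewrite dotZr wp mulrA mulVf // mul1r.
pose q1 := ((h - 1) / h) *: q.
have hn0 : h != 0 by rewrite gt_eqF.
have h1n0 : h - 1 != 0 by rewrite gt_eqF // subr_gt0.
have Pq1 : P q1.
  have t0 : 0 <= (h - 1) / h by apply: divr_ge0; lra.
  have t1 : (h - 1) / h <= 1 by rewrite ler_pdivrMr //; lra.
  by have := Pcvx t0 t1 Pq P0; rewrite scaler0 addr0.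
have wq1 : dot w q1 = h - 1 by rewrite dotZr wq divfK.
have q1E : q1 = a + e + dot f (q1 - a) *: (b - a) + dot g (q1 - a) *: (c - a).
  rewrite -{1}(subrK a q1) {1}(fb_expansion B (q1 - a)) [dot w _]dotBr wa wq1.
  by apply/rowP => i; rewrite !mxE; ring.
have pq1 : p = ((l + m + r) * h / (h - 1)) *: q1.
  by rewrite /q1 scalerA {1}pq; congr (_ *: _); field; rewrite h1n0 hn0.
rewrite pq1 q1E in pZ *.
have [fq gq] := fb_cone B Pq1.
apply: (@triangle_decomposes _ _ _ Pcvx Psym _ _ _ _ (k + 1)) => //.
- lra.
- exact: fb_edge B.
- exact: latticeD.
- exact: latticeB.
- exact: latticeB.
- by have := cone _ Pq1; rewrite wq1; lra.
- apply/andP; split; first by apply: divr_ge0; [apply: mulr_ge0;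
  [rewrite !addr_ge0|lra] | lra].
  rewrite ler_pdivrMr ?subr_gt0 // -wp; move: zn; rewrite /z; lra.
Qed.

Lemma flip_decomposes a b c n p : conic [:: a; b;
  c] p -> facet P w h a -> facet P w h b ->
  facet P w h c ->
  lattice_points a -> lattice_points b -> lattice_points c -> P (b + c - a) ->
  lattice_points p -> dilate n P p -> (0 < n)%N -> decomposes P n p.
Proof.
move=> /conic3P[l [m [r [l0 m0 r0 pE]]]] [Pa wa] [Pb wb] [Pc wc]
  aZ bZ cZ Pd pZ [y Py yp] n0.
have wp : dot w p = (l + m + r) * h.
  by rewrite pE !dotDr !dotZr wa wb wc -!mulrDl.
have sn : l + m + r <= n%:R.
  by rewrite -(ler_pM2r h0) -wp -yp dotZr ler_wpM2l // wP.
have pE' : p = (l + m + r) *: (a + (m / (l + m + r)) *: (b - a) + (r / (l + m + r))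
  *: (c - a)).
  have [s0|s0] := eqVneq (l + m + r) 0.
    rewrite s0 scale0r pE.
    have [-> -> ->] : [/\ l = 0, m = 0 & r = 0] by split; lra.
    by rewrite !scale0r !addr0.
  by rewrite pE; apply/rowP => i; rewrite !mxE; field.
rewrite pE' in pZ *.
have s0 : 0 <= l + m + r by rewrite !addr_ge0.
have div01 (v : R) : 0 <= v -> v <= l + m + r -> 0 <= v / (l + m + r) <= 1.
  move=> v0 vs; rewrite divr_ge0 //=; have [->|sn0] := eqVneq (l + m + r) 0.
    by rewrite invr0 mulr0 ler01.
  by rewrite ler_pdivrMr ?mul1r // lt_neqAle eq_sym sn0.
apply: (parallelogram_decomposes Pcvx Psym (a := a) (b := b) (c := c)) => //.
- by rewrite s0 sn.
- by apply: div01 => //; lra.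
- by apply: div01 => //; lra.
Qed.

End StuckDecomposition.

(** * The cone over a facet *)

Section Facets.
Variable R : realType.
Local Notation V := 'rV[R]_3.
Variables (P : set V) (S : seq V) (e u : V -> 'I_3 -> V).
Hypothesis SZ : {in S, forall s, lattice_points s}.
Hypothesis PS : P = convex_hull [set` S].
Hypothesis Ssmooth : {in S, forall v, smooth_vertex P v (e v) (u v)}.
Hypothesis Psym : forall x, P x -> P (- x).
Implicit Types (a b c f g p v x : V).

Let SP s : s \in S -> P s.
Proof. by rewrite PS; exact: hull_mem. Qed.

Lemma vertex_cones x v0 : v0 \in S ->
  {in S, forall v, forall i, 0 <= dot (u v i) (x - v)} -> P x.
Proof.
move=> v0S cone; have [|[g [c [gS gx]]]] := hull_sep S x; first by rewrite -PS.
have [v vS vmax] := seq_argmax (dot g) v0S.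
have sv := Ssmooth vS; suff : dot g (x - v) <= 0.
  by rewrite dotBr subr_le0 leNgt (le_lt_trans (gS v vS) gx).
rewrite (dual_expansion sv (x - v)) dot_sumr; apply: sumr_le0 => i _; rewrite dotZr.
rewrite mulr_ge0_le0 ?cone //.
have := sv_edge sv i; rewrite {1}PS => /(hull_le vmax).
by rewrite dotDr gerDl.
Qed.

Lemma vertex_height v i : v \in S -> 0 < - dot (u v i) v.
Proof.
move=> vS; have sv := Ssmooth vS.
have Pvi := sv_edge sv i.
have := sv_cone sv i (Psym Pvi); have := sv_cone sv i (Psym (SP vS)).
by rewrite !dotr (dual_pairing sv) eqxx /=; lra.
Qed.

(* The ray through p leaves P through the facet that maximizes the ratio of the normal
   at p to its value on the facet. *)
Lemma facet_through p v0 : v0 \in S -> p != 0 -> exists v i (k : R),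
  [/\ v \in S, 0 < k & facet P (- u v i) (- dot (u v i) v) (k^-1 *: p)].
Proof.
move=> v0S p0.
pose ratio (vi : V * 'I_3) := dot (- u vi.1 vi.2) p / (- dot (u vi.1 vi.2) vi.1).
have [[v i]] : exists2 vi, vi \in [seq (v, i) | v <- S, i <- enum 'I_3] &
    {in [seq (v, i) | v <- S, i <- enum 'I_3], forall vi', ratio vi' <= ratio vi}.
  apply: (@seq_argmax _ _ _ _ (v0, ord0)).
  by apply/allpairsP; exists (v0, ord0); rewrite mem_enum.
case/allpairsP => -[v' i'] /= [v'S _ [-> ->]] {v i} vmax.
move: v' i' v'S vmax => v i vS vmax.
have le_ratio v' i' : v' \in S -> dot (- u v' i') p <= ratio (v,
  i) * (- dot (u v' i') v').
  move=> v'S; rewrite -ler_pdivrMr ?vertex_height //; apply: (vmax (v', i')).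
  by apply/allpairsP; exists (v', i'); rewrite mem_enum.
have [kpos|kneg] := ltrP 0 (ratio (v, i)); last first.
  have up0 v' i' : v' \in S -> 0 <= dot (u v' i') p.
    move=> v'S; have := le_ratio v' i' v'S; rewrite dotNl.
    by have := vertex_height i' v'S; nra.
  have Pt (t : R) : 0 <= t -> P (t *: p).
    move=> t0; apply: (vertex_cones v0S) => v' v'S i'; rewrite dotBr dotZr.
    have := vertex_height i' v'S; have := mulr_ge0 t0 (up0 v' i' v'S); lra.
  case/eqP: p0; rewrite (dual_expansion (Ssmooth v0S) p) big1 // => j _.
  suff -> : dot (u v0 j) p = 0 by rewrite scale0r.
  apply/eqP; rewrite eq_le up0 // andbT leNgt; apply/negP => pos.
  have hv := vertex_height j v0S.
  have t0 : 0 <= (- dot (u v0 j) v0 + 1) / dot (u v0 j) p by apply: divr_ge0; lra.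
  have := sv_cone (Ssmooth v0S) j (Psym (Pt _ t0)).
  by rewrite !dotr divfK ?gt_eqF //; lra.
exists v, i, (ratio (v, i)); split=> //; split.
  apply: (vertex_cones vS) => v' v'S i'; rewrite dotBr dotZr.
  have := le_ratio v' i' v'S; rewrite dotNl => h.
  suff : dot (u v' i') v' * ratio (v, i) <= dot (u v' i') p.
    by rewrite -ler_pdivlMr // [_ / _]mulrC; lra.
  lra.
rewrite dotZr /ratio /= invf_div divfK //.
apply: contraTneq kpos => E; by rewrite /ratio /= E mul0r ltxx.
Qed.

Lemma facet_base v i : v \in S -> exists a b c,
  lattice_triangle P (- u v i) (- dot (u v i) v) a b c.
Proof.
move=> vS; have sv := Ssmooth vS.
have [j [ji _]] := third_index i i; have [k [ki kj]] := third_index i j.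
have pair := dual_pairing sv.
exists v, (v + e v j), (v + e v k); split.
  have Fe l : l != i -> facet P (- u v i) (- dot (u v i) v) (v + e v l) /\
    lattice_points (v + e v l).
    move=> li; split; last by apply: latticeD; [exact: SZ | exact: dual_lattice sv l].
    split; first exact: sv_edge sv l.
    by rewrite dotNl dotDr pair eq_sym (negbTE li) addr0.
  move=> x; rewrite !inE => /or3P[/eqP->|/eqP->|/eqP->]; [|exact: Fe|exact: Fe].
  by split; [split; [exact: SP | rewrite dotNl] | exact: SZ].
suff : det3 v (v + e v j) (v + e v k) * det3 (u v i) (u v j) (u v k) != 0.
  by rewrite mulf_eq0 negb_or => /andP[].
have nij : (i == j) = false by rewrite eq_sym (negbTE ji).
have nik : (i == k) = false by rewrite eq_sym (negbTE ki).
have njk : (j == k) = false by rewrite eq_sym (negbTE kj).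
rewrite det3_gram !dotDr !pair !eqxx nij nik njk (negbTE kj) /=.
have hv := vertex_height i vS.
set x := dot _ v; set y := dot _ v; set z := dot _ v.
rewrite [X in X != 0](_ : _ = x); last by ring.
by rewrite lt_eqF // -oppr_gt0.
Qed.

End Facets.

Section SmoothSymmetric.
Variable R : realType.
Local Notation V := 'rV[R]_3.

Lemma smooth_symmetric_decomposes (P : set V) n p :
  lattice_polytope P -> has_dim P 3 -> smooth P -> centrally_symmetric P ->
  (0 < n)%N -> dilate n P p -> lattice_points p -> decomposes P n p.
Proof.
move=> latP dimP smP symP n0 Pp pZ.
have [S [SZ PS Ssmooth]] := smooth_vertices latP dimP smP.
have Psym x : P x -> P (- x) by move=> Px; rewrite symP; exists x.
have Pcvx : cvx P by rewrite PS; exact: hull_cvx.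
have /choice[eu euP] : forall v, exists eu : ('I_3 -> V) * ('I_3 -> V),
    v \in S -> smooth_vertex P v eu.1 eu.2.
  move=> v; have [vS|_] := boolP (v \in S); last by exists (fun=> 0, fun=> 0).
  by have [e [u sv]] := Ssmooth v vS; exists (e, u).
have [y Py _] := Pp.
have [v0 v0S] : exists v0, v0 \in S.
  case: (S) PS => [|v0 S' _]; last by exists v0; exact: mem_head.
  move=> P0; have [] : (set0 : set V) y.
  move: y Py; rewrite P0; exact: hull_min.
pose e v := (eu v).1; pose u v := (eu v).2.
have SU : {in S, forall v, smooth_vertex P v (e v) (u v)} by move=> v /euP.
have [p0|p0] := eqVneq p 0.
  exists (fun=> (0 : V)); split; last by rewrite p0 big1.
  by move=> _; split; [exact: (cvx_sym0 Pcvx Psym Py) | exact: lattice0].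
have [v [i [k [vS k0 Fp]]]] := facet_through PS SU Psym v0S p0.
have h0 := vertex_height PS SU Psym i vS.
have sv := SU v vS.
have wP x : P x -> dot (- u v i) x <= - dot (u v i) v.
  by move=> Px; have := sv_cone sv i Px; rewrite dotNl dotBr; lra.
have [a [b [c abc]]] := facet_base SZ PS SU Psym i vS.
have con := facet_conic PS wP Fp.
have [|a' [b' [c' [abc' con']]]] := caratheodory abc _ con.
  move=> s; rewrite mem_filter => /andP[/eqP ws sS]; split; last exact: SZ.
  by split=> //; rewrite PS; exact: hull_mem.
have [a1 [b1 [c1 [T U con1]]]] := unimodular_triangle Pcvx h0 abc' con'.
have conp : conic [:: a1; b1; c1] p.
  have := conicZ (ltW k0) con1; rewrite scalerA divff ?scale1r //.
  by rewrite gt_eqF.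
have [Fa Fb Fc] := lattice_triangle_facet T.
have [aZ bZ cZ] := lattice_triangle_lattice T.
have rot q r s : conic [:: q; r; s] p -> conic [:: r; s; q] p.
  move=> /conic3P[l [m [t [l0 m0 t0 ->]]]]; apply/conic3P; exists m, t, l.
  by split=> //; rewrite -addrA addrC.
have [fa|fa] := pselect (P (b1 + c1 - a1)).
  exact: (flip_decomposes PS Psym wP h0 conp).
have [fb|fb] := pselect (P (c1 + a1 - b1)).
  exact: (flip_decomposes PS Psym wP h0 (rot _ _ _ conp)).
have [fc|fc] := pselect (P (a1 + b1 - c1)).
  exact: (flip_decomposes PS Psym wP h0 (rot _ _ _ (rot _ _ _ conp))).
have st : stuck P (- u v i) (- dot (u v i) v) a1 b1 c1 by split.
apply: (stuck_decomposes SZ PS Ssmooth Psym wP h0 _ (dual_lattice sv i) _ st) => //.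
  exact/latticeN/(dual_integral sv i).
by rewrite dotNl (dual_pairing sv) eqxx.
Qed.

End SmoothSymmetric.

Theorem theorem1p4 (R : realType) (P : set 'rV[R]_3) :
  lattice_polytope P -> has_dim P 3 -> smooth P -> centrally_symmetric P ->
  IDP P.
Proof.
move=> latP dimP smP symP n n0 p Pp pZ.
exact: smooth_symmetric_decomposes.
Qed.
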